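(* Let $X$ and $Y$ be Banach spaces, let $T:X\to Y$ be a bounded linear operator, and let $p\ge 1$ be an integer. Then $$\delta^{\max}(T|\mathcal W_{2^p},\mathcal W_{2^p})\le \mu_p(T)\le 2\,\delta^{\max}(T|\mathcal W_{2^p},\mathcal W_{2^p}).$$
   Context: For a Banach space $X$, $L_2^X$ is the Banach space of all (strongly) measurable $f:[0,1]\to X$ with $\|f\|_2:=\left(\int_0^1\|f(t)\|^2\,dt\right)^{1/2}<\infty$. Rademacher functions: $r_1(t)=+1$ for $t\in[0,\tfrac12)+\mathbb Z$, $r_1(t)=-1$ for $t\in[\tfrac12,1)+\mathbb Z$, and $r_{i+1}(t)=r_1(2^it)$. Walsh functions: for an integer $n\ge 0$ with binary expansion $n=\sum_{i\ge0}n_i2^i$, $n_i\in\{0,1\}$, put $w_n(t)=\prod_{i\ge0}r_{i+1}(t)^{n_i}$. For $f\in L_2^X$ put $\langle f,w_i\rangle=\int_0^1f(t)w_i(t)\,dt\in X$ and $S_n(f)=\sum_{i=0}^{n-1}\langle f,w_i\rangle w_i$. For a bounded linear operator $T:X\to Y$, $\delta(T|\mathcal W_n,\mathcal W_n)$ is the least constant $c\ge0$ such that $\|TS_n(f)\|_2\le c\|f\|_2$ for all $f\in L_2^X$ (where $T$ is applied pointwise), and $\delta^{\max}(T|\mathcal W_n,\mathcal W_n)=\max_{1\le k\le n}\delta(T|\mathcal W_k,\mathcal W_k)$. Dyadic intervals: $\Delta_k^{(n)}=[\frac{k-1}{2^n},\frac{k}{2^n})$, $k=1,\dots,2^n$.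 A dyadic martingale is a martingale $(M_0,M_1,\dots)$ on $[0,1)$ with Lebesgue measure relative to the filtration $(\mathcal F_n)$, where $\mathcal F_n$ is generated by $\{\Delta_k^{(n)}:k=1,\dots,2^n\}$. Put $dM_i:=M_{i+1}-M_i$. For $p\ge1$, $\mu_p(T)$ is the least constant $c\ge0$ such that for all $X$-valued dyadic martingales $(M_0,\dots,M_p)$ and all signs $\varepsilon_0,\dots,\varepsilon_{p-1}\in\{+1,-1\}$, $$\left\|\sum_{i=0}^{p-1}\varepsilon_i\,T\,dM_i\right\|_2\le c\,\|M_p\|_2 .$$ *)

(* Defs.v *)
From HB Require Import structures.
From mathcomp Require Import all_boot all_order all_algebra.
From mathcomp Require Import all_classical all_reals all_analysis.

Set Implicit Arguments.
Unset Strict Implicit.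
Unset Printing Implicit Defensive.

Import Order.TTheory GRing.Theory Num.Theory.
Import numFieldNormedType.Exports.

Local Open Scope classical_set_scope.
Local Open Scope ring_scope.

(* Vector-valued functions are total functions on the real line; each notion
   takes the domain [D] on which the function is considered, and does not
   depend on the values outside [D].  In this file [D] is always a Borel
   subset of [0, 1], so it has finite measure. *)

Section bochner.
Context {R : realType} {X : completeNormedModType R}.
Implicit Types (F : set (set R)) (D : set R) (f g s : R -> X).

Local Notation mu := (@lebesgue_measure R).

Definition borel_sets : set (set R) := @measurable _ (measurableTypeR R).

Definition simple F D s : Prop :=
  finite_set (s @` D) /\ forall x, F (D `&` s @^-1` [set x]).

Definition strongly_measurable F D f : Prop :=
  exists s : nat -> R -> X, (forall n, simple F D (s n)) /\
    forall t, D t -> s n t @[n --> \oo] --> f t.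

(* Strong measurability with respect to the Lebesgue measure: equivalently,
   [f] is almost everywhere the limit of a sequence of simple functions. *)
Definition ae_strongly_measurable D f : Prop :=
  exists g, strongly_measurable borel_sets D g /\
    {ae mu, forall t, D t -> f t = g t}.

Definition simple_integral D s : X :=
  \sum_(x \in s @` D) fine (mu (D `&` s @^-1` [set x])) *: x.

Definition has_bochner_integral D f (x : X) : Prop :=
  ae_strongly_measurable D f /\
  exists s : nat -> R -> X,
    [/\ forall n, simple borel_sets D (s n),
        (\int[mu]_(t in D) (`|f t - s n t|)%:E)%E @[n --> \oo] --> 0%E &
        simple_integral D (s n) @[n --> \oo] --> x].

Definition bochner_integrable D f : Prop := exists x, has_bochner_integral D f x.

Definition bochner_integral D f : X := xget 0 (has_bochner_integral D f).

Definition l2norm D f : \bar R :=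
  sqrte (\int[mu]_(t in D) (`|f t| ^+ 2)%:E)%E.

Definition mem_L2 D f : Prop :=
  ae_strongly_measurable D f /\ (l2norm D f < +oo)%E.

End bochner.

Section walsh.
Context {R : realType}.

Definition rademacher1 (t : R) : R :=
  if t - (Num.floor t)%:~R < 2^-1 then 1 else -1.

(* Indexed from 0: [rademacher i] is the function usually written r_(i+1). *)
Definition rademacher (i : nat) (t : R) : R := rademacher1 (2 ^+ i * t).

(* The i-th binary digit of [n] is [odd (n %/ 2 ^ i)]; it vanishes for
   [n <= i], so the product over [i < n] contains all nontrivial factors. *)
Definition walsh (n : nat) (t : R) : R :=
  \prod_(i < n) rademacher i t ^+ odd (n %/ 2 ^ i)%N.

Context {X : completeNormedModType R}.

Definition walsh_coef (f : R -> X) (i : nat) : X :=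
  bochner_integral `[0, 1] (fun t => walsh i t *: f t).

Definition walsh_sum (n : nat) (f : R -> X) (t : R) : X :=
  \sum_(i < n) walsh i t *: walsh_coef f i.

End walsh.

Section martingale.
Context {R : realType} {X : completeNormedModType R}.

(* Here [k] ranges over 0, ..., 2 ^ n - 1. *)
Definition dyadic_interval (n k : nat) : set R :=
  `[k%:R / 2 ^+ n, k.+1%:R / 2 ^+ n[.

Definition dyadic_algebra (n : nat) : set (set R) :=
  <<s `[0, 1[, [set dyadic_interval n k | k in [set k | (k < 2 ^ n)%N]] >>.

(* The conditional expectation of [M n.+1] given [F n] is [M n], for every
   [n < p]; the values of the sequence [M] beyond index [p] are irrelevant. *)
Definition martingale (F : nat -> set (set R)) (D : set R) (p : nat)
    (M : nat -> R -> X) : Prop :=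
  (forall n, (n <= p)%N ->
     strongly_measurable (F n) D (M n) /\ bochner_integrable D (M n)) /\
  (forall n, (n < p)%N -> forall A, F n A ->
     bochner_integral A (M n.+1) = bochner_integral A (M n)).

Definition dyadic_martingale (p : nat) (M : nat -> R -> X) : Prop :=
  martingale dyadic_algebra `[0, 1[ p M.

End martingale.

Section constants.
Context {R : realType} {X Y : completeNormedModType R}.
Implicit Type T : X -> Y.
Local Open Scope ereal_scope.

(* The least constant [c >= 0] satisfying [P], with value [+oo] when no real
   constant satisfies [P]. *)
Definition least_constant (P : R -> Prop) : \bar R :=
  ereal_inf [set c%:E | c in [set c : R | (0 <= c)%R /\ P c]].

Definition walsh_delta T (n : nat) : \bar R :=
  least_constant (fun c => forall f : R -> X, mem_L2 `[0%R, 1%R] f ->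
    l2norm `[0%R, 1%R] (T \o walsh_sum n f) <= c%:E * l2norm `[0%R, 1%R] f).

Definition walsh_delta_max T (n : nat) : \bar R :=
  \big[maxe/-oo]_(1 <= k < n.+1) walsh_delta T k.

Definition martingale_mu T (p : nat) : \bar R :=
  least_constant (fun c =>
    forall (M : nat -> R -> X) (eps : nat -> bool), dyadic_martingale p M ->
      l2norm `[0%R, 1%R[
        (fun t => \sum_(i < p) (-1) ^+ eps i *: T (M i.+1 t - M i t))%R
      <= c%:E * l2norm `[0%R, 1%R[ (M p)).

End constants.

(* Main.v *)
Require Import Defs.
From HB Require Import structures.
From mathcomp Require Import all_boot all_order all_algebra finmap.
From mathcomp Require Import all_classical all_reals all_analysis.
From mathcomp Require Import measurable_realfun.
From mathcomp Require Import ring lra zify.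

Import Order.TTheory GRing.Theory Num.Theory.
Import numFieldNormedType.Exports.

Local Open Scope classical_set_scope.
Local Open Scope ring_scope.

(** The partial sums of Walsh-Fourier series are martingale transforms in
    disguise.  With rho q = r_q(t) r_q(s) ([rademacher_pair]), where the r_q
    are the Rademacher functions, the operator S_k has the kernel
    sum_(i < k) w_i(t) w_i(s), and the summand of index i is the product of the rho q over the binary digits
    of i equal to 1.  Since rho q ^ 2 = 1, an induction on the leading digit of
    k < 2 ^ n ([sum_binary_prod_digits]) turns this kernel into

      w_k(t) w_k(s) sum_(m < n, k_m = 1) rho m prod_(q < m) (1 + rho q).

    Two features of the right-hand side matter.  The product
    prod_(q < m) (1 + rho q) is 2 ^ m times the indicator of s and t lying in
    the same dyadic interval of length 2 ^ -m ([prod_rademacher]), so it is the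
    kernel of the conditional expectation E_m, which is S_(2 ^ m); and
    rho m prod_(q < m) (1 + rho q) is the kernel of E_(m+1) - E_m.  Hence
    ([walsh_sum_digits])

      S_k f = w_k sum_(k_m = 1) (E_(m+1) g - E_m g),   g = w_k f,

    and |w_k| = 1, so S_k f has the same pointwise norm as the sum of those
    increments of the dyadic martingale of g whose index is a binary digit 1
    of k.  Conversely every dyadic martingale of length p is (E_n M_p)_n
    ([dyadic_martingaleE]), and every subset of its increments is selected by
    the digits of some k < 2 ^ p.

    Upper bound on the Walsh constants ([walsh_bound_lt], [walsh_bound_pow2]):
    a partial sum of increments is half the sum of two signed sums of
    increments, and E_p is a contraction of L2
    ([integral_walsh_sum_pow2_le]).  The length 2 ^ p, where S_k = E_p itself,
    is handled by the norm bound on T read off from k = 1 and constant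
    functions.  Upper bound on the martingale constant
    ([martingale_bound_walsh]): a signed sum of increments is the difference
    of two partial sums of increments, whence the factor 2.  In place of the
    triangle inequality of L2, both bounds use
    |a + b| ^ 2 <= 2 (|a| ^ 2 + |b| ^ 2) ([sqintD_le]).

    The analytic part develops the Bochner integral: uniqueness, linearity,
    restriction to subsets, and existence for strongly measurable functions
    with integrable norm. *)

Set Implicit Arguments.
Unset Strict Implicit.
Unset Printing Implicit Defensive.

(** * Integrals of arbitrary nonnegative functions *)

Section lower_integral.
Import HBNNSimple.
Context d (T : measurableType d) (R : realType).
Variable mu : {measure set T -> \bar R}.
Implicit Types (D : set T) (f g : T -> \bar R).
Local Open Scope ereal_scope.

(** The integral of a nonnegative function is the supremum of the integrals of
    the simple functions below it, and cutting such a simple function off on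
    a null set does not change its integral; hence comparison outside a null
    set suffices, for arbitrary nonnegative functions.  The norm of a function
    that is only almost everywhere equal to a Borel one is of this kind. *)
Lemma ge0_ae_le_integralW D f g :
  (forall x, D x -> 0 <= f x) -> (forall x, D x -> 0 <= g x) ->
  {ae mu, forall x, D x -> f x <= g x} ->
  \int[mu]_(x in D) f x <= \int[mu]_(x in D) g x.
Proof.
move=> f0 g0 [N [mN N0 subN]].
rewrite !ge0_integralE//; apply/ge_ereal_sup => _ [h /= hf <-].
have [h' h'E] : exists h' : {nnsfun T >-> R},
    forall x, h' x = (h x * \1_(~` N) x)%R.
  by exists (proj_nnsfun h (measurableC mN)).
have -> : sintegral mu h = sintegral mu h'.
  rewrite -!integralT_nnsfun; apply: ge0_ae_eq_integral => //.
  - exact/measurable_EFinP.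
  - exact/measurable_EFinP.
  - by move=> x _; rewrite lee_fin.
  - by move=> x _; rewrite lee_fin.
  - exists N; split => // x /= H; apply: contrapT => Nx; apply: H => _.
    by rewrite h'E indicE in_setC memNset// mulr1.
apply: ereal_sup_ubound; exists h' => //= x.
have := hf x; rewrite /patch; case: ifPn => [/set_mem Dx|_].
  case: (pselect (N x)) => [Nx _|Nx].
    by rewrite h'E indicE in_setC mem_set//= mulr0 g0.
  rewrite h'E indicE in_setC memNset//= mulr1 => /le_trans; apply.
  by apply: contrapT => H; apply: Nx; apply: subN => /=; move=> /(_ Dx).
by rewrite h'E !lee_fin indicE => hx; rewrite mulr_le0_ge0.
Qed.

Lemma ge0_le_integralW D f g :
  (forall x, D x -> 0 <= f x) -> (forall x, D x -> f x <= g x) ->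
  \int[mu]_(x in D) f x <= \int[mu]_(x in D) g x.
Proof.
move=> f0 fg; apply: ge0_ae_le_integralW => //; last exact/aeW.
by move=> x Dx; exact: le_trans (f0 _ Dx) (fg _ Dx).
Qed.

Lemma ge0_ae_eq_integralW D f g :
  (forall x, D x -> 0 <= f x) -> (forall x, D x -> 0 <= g x) ->
  {ae mu, forall x, D x -> f x = g x} ->
  \int[mu]_(x in D) f x = \int[mu]_(x in D) g x.
Proof.
move=> f0 g0 fg; apply/eqP; rewrite eq_le; apply/andP; split;
  apply: ge0_ae_le_integralW => //.
- by apply: filterS fg => x H Dx; rewrite H.
- by apply: filterS fg => x H Dx; rewrite H.
Qed.

(** A class on which the integral of nonnegative functions is additive and which
    contains the norms of almost everywhere strongly measurable functions. *)
Definition ae_measurable_ge0 D f := exists2 h, measurable_fun D h &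
  (forall x, D x -> 0 <= h x) /\ {ae mu, forall x, D x -> f x = h x}.

Lemma ge0_integralD_ae D f g : measurable D ->
  (forall x, D x -> 0 <= f x) -> (forall x, D x -> 0 <= g x) ->
  ae_measurable_ge0 D f -> ae_measurable_ge0 D g ->
  \int[mu]_(x in D) (f x + g x) =
  \int[mu]_(x in D) f x + \int[mu]_(x in D) g x.
Proof.
move=> mD f0 g0 [f' mf' [f'0 ff']] [g' mg' [g'0 gg']].
rewrite (@ge0_ae_eq_integralW D f f')// (@ge0_ae_eq_integralW D g g')//.
rewrite -ge0_integralD//; apply: ge0_ae_eq_integralW.
- by move=> x Dx; rewrite adde_ge0 ?f0 ?g0.
- by move=> x Dx; rewrite adde_ge0 ?f'0 ?g'0.
- by apply: filterS2 ff' gg' => x + + Dx => -> // ->.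
Qed.

End lower_integral.

(** * Simple functions *)

Section simple_functions.
Context {R : realType}.
Local Notation mu := (@lebesgue_measure R).
Implicit Types (X Y Z : completeNormedModType R).
Implicit Types D A : set (measurableTypeR R).

(** A preimage is a finite union of level sets. *)
Lemma measurable_simple_preimage X D (s : R -> X) (Q : set X) :
  simple borel_sets D s ->
  measurable (D `&` s @^-1` Q : set (measurableTypeR R)).
Proof.
move=> [fs ms].
have -> : D `&` s @^-1` Q =
    \bigcup_(x in (s @` D) `&` Q) (D `&` s @^-1` [set x]).
  apply/seteqP; split=> [t [Dt Qt]|t [x [_ Qx] [Dt /= e]]].
    by exists (s t) => //; split => //; exists t.
  by split => //=; rewrite e.
apply: fin_bigcup_measurable => [|x _]; last exact: ms.
exact: sub_finite_set fs.
Qed.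

Lemma simple_comp X Y D (h : X -> Y) (s : R -> X) :
  simple borel_sets D s -> simple borel_sets D (h \o s).
Proof.
move=> ss; split.
  by rewrite -image_comp; apply: finite_image; case: ss.
by move=> y; rewrite comp_preimage; exact: measurable_simple_preimage.
Qed.

Lemma simple_comp2 X Y Z D (h : X -> Y -> Z) (s : R -> X) (s' : R -> Y) :
  simple borel_sets D s -> simple borel_sets D s' ->
  simple borel_sets D (fun t => h (s t) (s' t)).
Proof.
move=> ss ss'; split.
  apply: sub_finite_set (finite_image2 h (proj1 ss) (proj1 ss')).
  by move=> _ [t Dt <-]; exists (s t); [exists t|exists (s' t)=> //; exists t].
move=> z; have -> : D `&` (fun t => h (s t) (s' t)) @^-1` [set z] =
  \bigcup_(x in s @` D) ((D `&` s @^-1` [set x]) `&`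
     (D `&` s' @^-1` [set y | h x y = z])).
  apply/seteqP; split=> [t [Dt /= ht]|t [x _ [[Dt /= e] [_ /= ht]]]].
    by exists (s t); [exists t|].
  by split => //=; rewrite e.
apply: fin_bigcup_measurable => [|x _]; first by case: ss.
apply: measurableI; exact: measurable_simple_preimage.
Qed.

Lemma simpleS X D A (s : R -> X) : measurable A -> A `<=` D ->
  simple borel_sets D s -> simple borel_sets A s.
Proof.
move=> mA AD [fs ms]; split.
  by apply: sub_finite_set fs; exact: image_subset.
move=> x; have -> : A `&` s @^-1` [set x] = A `&` (D `&` s @^-1` [set x]).
  by rewrite setIA (setIidl AD).
exact: measurableI (ms x).
Qed.

Lemma simple_cst X D (x : X) : measurable D -> simple borel_sets D (fun=> x).
Proof.
move=> mD; split.
  by apply: sub_finite_set (finite_set1 x) => _ [t _ <-].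
move=> y; have [<-|xy] := pselect (x = y).
  by have -> : D `&` (fun=> x) @^-1` [set x] = D by apply: setIidl.
have -> : D `&` (fun=> x) @^-1` [set y] = set0 by apply/seteqP; split=> // t [].
exact: measurable0.
Qed.

Lemma simple_restrict X D A (s : R -> X) : measurable D -> measurable A ->
  A `<=` D -> simple borel_sets A s ->
  simple borel_sets D (fun t => \1_A t *: s t).
Proof.
move=> mD mA AD ss; split.
  apply: (@sub_finite_set _ _ (s @` A `|` [set 0])).
    move=> _ [t Dt <-]; rewrite indicE; have [/set_mem At|_] := boolP (t \in A).
      by rewrite scale1r; left; exists t.
    by rewrite scale0r; right.
  by rewrite finite_setU; split => //; case: ss.
move=> x.
have -> : D `&` (fun t => \1_A t *: s t) @^-1` [set x] =
    (A `&` s @^-1` [set x]) `|` ((D `\` A) `&` (fun=> 0) @^-1` [set x]).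
  apply/seteqP; split=> [t [Dt /=]|t].
    rewrite indicE; have [/set_mem At|/negP At] := boolP (t \in A).
      by rewrite scale1r; left.
    rewrite scale0r; right; split => //; split => // At'.
    by apply: At; exact: mem_set.
  move=> [[At <-]|[[Dt At] <-]]; split => //=; first exact: AD.
    by rewrite indicE mem_set// scale1r.
  by rewrite indicE memNset// scale0r.
apply: measurableU; first exact: (proj2 ss).
by apply: (proj2 (@simple_cst _ _ 0 _)); exact: measurableD.
Qed.

Lemma measurable_fun_simple X D (h : X -> R) (s : R -> X) :
  simple borel_sets D s -> measurable_fun (D : set (measurableTypeR R)) (h \o s).
Proof.
by move=> ss _ B _; rewrite comp_preimage; exact: measurable_simple_preimage.
Qed.

Section simple_integral.
Context {X : completeNormedModType R}.
Variable D : set (measurableTypeR R).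
Hypotheses (mD : measurable D) (fD : (mu D < +oo)%E).
Implicit Types s : R -> X.

Let fin_sub (A : set (measurableTypeR R)) : measurable A -> A `<=` D ->
  mu A = (fine (mu A))%:E.
Proof.
move=> mA AD; rewrite fineK// ge0_fin_numE//.
by apply: (le_lt_trans _ fD); apply: le_measure => //; exact: mem_set.
Qed.

(** [simple_integral] groups the domain by the values of the function.  To add
    two simple functions one must group it by finer labels, such as pairs of
    values: the measure of a level set is the sum of the measures of the label
    cells that carry this value, and exchanging the two summations gives the
    formula. *)
Lemma simple_integral_label (J : choiceType) (K : set J) (c : R -> J)
    (a : J -> X) :
  finite_set K -> (forall t, D t -> K (c t)) ->
  (forall j, K j -> measurable (D `&` c @^-1` [set j])) ->
  simple_integral D (a \o c) =
  \sum_(j \in K) fine (mu (D `&` c @^-1` [set j])) *: a j.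
Proof.
move=> fK Kc mc; pose m j := fine (mu (D `&` c @^-1` [set j])).
have fI : finite_set ((a \o c) @` D).
  apply: sub_finite_set (finite_image a fK).
  by move=> _ [t Dt <-]; exists (c t) => //; exact: Kc.
have cell x : fine (mu (D `&` (a \o c) @^-1` [set x])) =
    \sum_(j <- fset_set K | a j == x) m j.
  have fA : finite_set (K `&` [set j | a j = x]) by exact: sub_finite_set fK.
  have -> : D `&` (a \o c) @^-1` [set x] =
     \bigcup_(j in K `&` [set j | a j = x]) (D `&` c @^-1` [set j]).
    apply/seteqP; split=> [t [Dt /= ax]|t [j [Kj /= aj] [Dt /= cj]]].
      by exists (c t) => //; split => //; exact: Kc.
    by split => //=; rewrite cj.
  rewrite -fsbig_setU// measure_fsbig//; last 2 first.
    - by move=> j [Kj _]; exact: mc.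
    - by move=> i j _ _ [t [[_ /= <-] [_ /= <-]]].
  rewrite (eq_fsbigr (fun j => (m j)%:E)); last first.
    by move=> j /set_mem[Kj _]; apply: fin_sub; [exact: mc|exact: subIsetl].
  rewrite fsumEFin//= fsbig_mkcondr fsbig_finite//= [RHS]big_mkcond/=.
  apply: eq_bigr => j _.
  by case: eqP => [e|ne]; [rewrite mem_set|rewrite memNset].
rewrite /simple_integral fsbig_finite// [RHS]fsbig_finite//=.
under eq_bigr do rewrite cell scaler_suml big_mkcond/=.
rewrite exchange_big/= big_seq [RHS]big_seq; apply: eq_bigr => j.
rewrite in_fset_set// => /set_mem Kj.
have [[t Dt aj]|nj] := pselect (((a \o c) @` D) (a j)).
  rewrite -big_mkcond/= (big_rem (a j))/=; last first.
    by rewrite in_fset_set// inE; exists t.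
  rewrite eqxx big_seq_cond big1 ?addr0// => x /andP[xr /eqP ax].
  by move: xr; rewrite -ax mem_rem_uniq ?fset_uniq// inE eqxx /=.
rewrite big_seq big1; last first.
  move=> x; rewrite in_fset_set// inE => -[t Dt <-].
  case: eqP => // ac; exfalso; apply: nj; exists t => //.
suff -> : D `&` c @^-1` [set j] = set0 by rewrite measure0 scale0r.
apply/seteqP; split => // t [Dt /= cj]; apply: nj; exists t => //=.
by rewrite cj.
Qed.

(** Values that are not attained contribute empty level sets, so any finite set
    of values containing the image may serve as index set. *)
Lemma simple_integralE s (K : set X) : finite_set K -> s @` D `<=` K ->
  simple borel_sets D s ->
  simple_integral D s = \sum_(x \in K) fine (mu (D `&` s @^-1` [set x])) *: x.
Proof.
move=> fK sK ss; rewrite -[s in LHS]/(idfun \o s).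
rewrite (@simple_integral_label _ K)//.
  by move=> t Dt; apply: sK; exists t.
by move=> j _; case: ss => _; exact.
Qed.

Lemma simple_integralD s s' :
  simple borel_sets D s -> simple borel_sets D s' ->
  simple_integral D (s \+ s') = simple_integral D s + simple_integral D s'.
Proof.
move=> ss ss'.
pose c t := (s t, s' t); pose K := (s @` D) `*` (s' @` D).
have fK : finite_set K by apply: finite_setX; [case: ss|case: ss'].
have Kc t : D t -> K (c t) by move=> Dt; split; exists t.
have mc j : K j -> measurable (D `&` c @^-1` [set j] : set (measurableTypeR R)).
  move=> _; have -> : D `&` c @^-1` [set j] =
    (D `&` s @^-1` [set j.1]) `&` (D `&` s' @^-1` [set j.2]).
    apply/seteqP; split => [t [Dt /= <-] //|t [[Dt /= e] [_ /= e']]].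
    by split => //=; rewrite /c e e'; case: (j).
  by apply: measurableI; apply: measurable_simple_preimage.
rewrite -[s \+ s']/((fun j => j.1 + j.2) \o c) -[s in RHS]/(fst \o c).
rewrite -[s' in RHS]/(snd \o c) !(simple_integral_label _ fK)//.
rewrite -fsbig_split//=; apply: eq_fsbigr => j _.
by rewrite scalerDr.
Qed.

Lemma simple_integralZ k s : simple borel_sets D s ->
  simple_integral D (fun t => k *: s t) = k *: simple_integral D s.
Proof.
move=> ss; have fK := proj1 ss.
rewrite -[fun t => _]/(( *:%R k) \o s) (@simple_integral_label _ (s @` D) s)//.
- rewrite (@simple_integralE s (s @` D))// !fsbig_finite//= scaler_sumr.
  by apply: eq_bigr => x _; rewrite !scalerA mulrC.
- by move=> x _; exact: (proj2 ss x).
Qed.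

(** The norm of a simple function is itself a finite combination of indicators
    of level sets, which makes its integral the sum of norms bounding the left
    side by the triangle inequality. *)
Lemma norm_simple_integral s : simple borel_sets D s ->
  ((`|simple_integral D s|)%:E <= \int[mu]_(t in D) (`|s t|)%:E)%E.
Proof.
move=> ss; have fK := proj1 ss.
have mE x : measurable (D `&` s @^-1` [set x] : set (measurableTypeR R)).
  exact: measurable_simple_preimage.
have sE t : D t -> (`|s t|)%:E = (\sum_(x \in s @` D)
    `|x|%:E * (\1_(D `&` s @^-1` [set x]) t)%:E)%E.
  move=> Dt; rewrite fsbig_finite//= (big_rem (s t))/=; last first.
    by rewrite in_fset_set// inE; exists t.
  rewrite big_seq big1 ?adde0; first by rewrite indicE mem_set// mule1.
  move=> x xr; rewrite indicE memNset ?mule0// => -[_ /= ex].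
  by move: xr; rewrite -ex mem_rem_uniq ?fset_uniq// inE eqxx /=.
rewrite (eq_integral _ _ (fun t Dt => sE t (set_mem Dt))).
rewrite ge0_integral_fsum//; last first.
  move=> x; apply: measurable_funeM; apply/measurable_EFinP.
  exact: measurable_indic.
rewrite /simple_integral fsbig_finite// [leRHS]fsbig_finite//=.
apply: (@le_trans _ _ (\sum_(x <- fset_set (s @` D))
   (fine (mu (D `&` s @^-1` [set x])) * `|x|)%:E)%E).
  rewrite sumEFin lee_fin; apply: le_trans (ler_norm_sum _ _ _) _.
  by apply: ler_sum => x _; rewrite normrZ ger0_norm// fine_ge0.
apply: lee_sum => x _; rewrite ge0_integralZl_EFin//; last first.
  by apply/measurable_EFinP; exact: measurable_indic.
rewrite integral_indic// setIAC setIid EFinM muleC.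
by rewrite -fin_sub//; exact: subIsetl.
Qed.

End simple_integral.

Lemma simple_integral_restrict X D A (s : R -> X) :
  measurable D -> (mu D < +oo)%E -> measurable A -> A `<=` D ->
  simple borel_sets A s ->
  simple_integral D (fun t => \1_A t *: s t) = simple_integral A s.
Proof.
move=> mD fD mA AD ss.
have sr := simple_restrict mD mA AD ss.
have fA : (mu A < +oo)%E.
  by apply: (le_lt_trans _ fD); apply: le_measure => //; exact: mem_set.
set r := (fun t => _) in sr *.
have fK : finite_set (r @` D `|` s @` A).
  by rewrite finite_setU; split; [case: sr|case: ss].
rewrite (simple_integralE _ _ fK)// (simple_integralE _ _ fK)//.
apply: eq_fsbigr => x _; have [->|x0] := eqVneq x 0; first by rewrite !scaler0.
congr (fine (mu _) *: _); apply/seteqP; split => t [Dt /= rx].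
  move: rx; rewrite /r indicE; have [/set_mem At|_] := boolP (t \in A).
    by rewrite scale1r.
  by rewrite scale0r => e; move: x0; rewrite -e eqxx.
by split; [exact: AD|rewrite /= /r indicE mem_set// scale1r].
Qed.

End simple_functions.

(** * Strong measurability *)

(** Makes the filter structure visible on the bare Lebesgue measure, the form
    in which almost everywhere statements about it are written. *)
#[local] Instance lebesgue_ae_filter (R : realType) :
  Filter (almost_everywhere (@lebesgue_measure R)).
Proof. exact: (ae_filter_ringOfSetsType (@lebesgue_measure R)). Qed.

Section strong_measurability.
Context {R : realType}.
Local Notation mu := (@lebesgue_measure R).
Implicit Types (X Y : completeNormedModType R).
Implicit Types D A : set (measurableTypeR R).

Lemma simple_strongly_measurable X D (s : R -> X) :
  simple borel_sets D s -> strongly_measurable borel_sets D s.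
Proof. by move=> ss; exists (fun=> s); split => // t _; exact: cvg_cst. Qed.

Lemma strongly_measurableD X D (f g : R -> X) :
  strongly_measurable borel_sets D f -> strongly_measurable borel_sets D g ->
  strongly_measurable borel_sets D (f \+ g).
Proof.
move=> [s [ss sf]] [s' [ss' sg]].
exists (fun n => s n \+ s' n); split => [n|t Dt].
  exact: (simple_comp2 (fun x y => x + y)).
by apply: cvgD; [exact: sf|exact: sg].
Qed.

Lemma strongly_measurableZ X D (u : R -> R) (f : R -> X) :
  simple borel_sets D u -> strongly_measurable borel_sets D f ->
  strongly_measurable borel_sets D (fun t => u t *: f t).
Proof.
move=> su [s [ss sf]].
exists (fun n t => u t *: s n t); split => [n|t Dt].
  exact: (simple_comp2 (fun (k : R) (x : X) => k *: x)).
by apply: cvgZr; exact: sf.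
Qed.

Lemma strongly_measurable_restrict X D A (f : R -> X) :
  measurable D -> measurable A -> A `<=` D ->
  strongly_measurable borel_sets A f ->
  strongly_measurable borel_sets D (fun t => \1_A t *: f t).
Proof.
move=> mD mA AD [s [ss sf]].
exists (fun n t => \1_A t *: s n t); split => [n|t Dt].
  exact: simple_restrict.
rewrite indicE; have [/set_mem At|_] := boolP (t \in A).
  by apply: cvgZr; exact: sf.
rewrite scale0r; under eq_fun do rewrite scale0r; exact: cvg_cst.
Qed.

(** Pointwise limit of the norms of the approximating simple functions. *)
Lemma measurable_fun_norm X D (f : R -> X) :
  strongly_measurable borel_sets D f ->
  measurable_fun D (fun t => `|f t|).
Proof.
move=> [s [ss sf]].
apply: (@measurable_fun_cvg _ _ _ D (fun n t => `|s n t|)) => [n|t Dt].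
  exact: (measurable_fun_simple (fun x : X => `|x|)).
by apply: cvg_norm; exact: sf.
Qed.

Lemma measurable_fun_norm_sub X D (f s : R -> X) :
  strongly_measurable borel_sets D f -> simple borel_sets D s ->
  measurable_fun D (fun t => `|f t - s t|).
Proof.
move=> sf ss.
apply: (@measurable_fun_norm _ _ (f \+ (fun t => - s t))).
apply: strongly_measurableD => //; apply: simple_strongly_measurable.
exact: (simple_comp (fun x : X => - x)).
Qed.

Lemma ae_strongly_measurable_sub X D (f s : R -> X) :
  ae_strongly_measurable D f -> simple borel_sets D s ->
  ae_measurable_ge0 mu D (fun t => (`|f t - s t|)%:E).
Proof.
move=> [g [sg fg]] ss; exists (fun t => (`|g t - s t|)%:E).
  by apply/measurable_EFinP; exact: measurable_fun_norm_sub.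
by split => [t _|]; [rewrite lee_fin|apply: filterS fg => t H Dt; rewrite H].
Qed.

Lemma ae_strongly_measurable_ae X D (f g : R -> X) :
  {ae mu, forall t, D t -> f t = g t} ->
  ae_strongly_measurable D f -> ae_strongly_measurable D g.
Proof.
move=> fg [h [sh fh]]; exists h; split => //.
by apply: filterS2 fg fh => t + + Dt => <- // ->.
Qed.

Lemma ae_strongly_measurableD X D (f g : R -> X) :
  ae_strongly_measurable D f -> ae_strongly_measurable D g ->
  ae_strongly_measurable D (f \+ g).
Proof.
move=> [f' [sf ff]] [g' [sg gg]]; exists (f' \+ g').
split; first exact: strongly_measurableD.
by apply: filterS2 ff gg => t /= + + Dt => -> // ->.
Qed.

Lemma ae_strongly_measurableZ X D (u : R -> R) (f : R -> X) :
  simple borel_sets D u -> ae_strongly_measurable D f ->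
  ae_strongly_measurable D (fun t => u t *: f t).
Proof.
move=> su [f' [sf ff]]; exists (fun t => u t *: f' t).
split; first exact: strongly_measurableZ.
by apply: filterS ff => t /= + Dt => ->.
Qed.

Lemma ae_strongly_measurable_restrict X D A (f : R -> X) :
  measurable D -> measurable A -> A `<=` D -> ae_strongly_measurable A f ->
  ae_strongly_measurable D (fun t => \1_A t *: f t).
Proof.
move=> mD mA AD [f' [sf ff]]; exists (fun t => \1_A t *: f' t).
split; first exact: strongly_measurable_restrict.
apply: filterS ff => t /= + Dt; rewrite indicE.
by have [/set_mem At ->|_ _] := boolP (t \in A); rewrite ?scale0r.
Qed.

End strong_measurability.

(** * The Bochner integral *)

Section bochner_integral.
Context {R : realType} {X : completeNormedModType R}.
Local Notation mu := (@lebesgue_measure R).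
Variable D : set (measurableTypeR R).
Hypotheses (mD : measurable D) (fD : (mu D < +oo)%E).
Implicit Types (f g s : R -> X) (x y : X).

Local Notation dist f s := (\int[mu]_(t in D) (`|f t - s t|)%:E)%E.

Let dist_ge0 f s : (0 <= dist f s)%E.
Proof. by apply: integral_ge0 => t _; rewrite lee_fin. Qed.

(** Any two approximations of [f] have close integrals.  This gives both the
    uniqueness of the Bochner integral and the Cauchy property behind its
    existence. *)
Lemma simple_integral_dist f s s' : ae_strongly_measurable D f ->
  simple borel_sets D s -> simple borel_sets D s' ->
  ((`|simple_integral D s - simple_integral D s'|)%:E <= dist f s + dist f s')%E.
Proof.
move=> mf ss ss'.
have sN : simple borel_sets D (fun t => -1 *: s' t).
  exact: (simple_comp (fun x : X => -1 *: x)).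
rewrite -scaleN1r -simple_integralZ// -simple_integralD//.
have sB := simple_comp2 (fun x y : X => x + y) ss sN.
apply: le_trans (norm_simple_integral mD fD sB) _.
rewrite -ge0_integralD_ae//; last 2 first.
- exact: ae_strongly_measurable_sub.
- exact: ae_strongly_measurable_sub.
apply: ge0_le_integralW => t _; rewrite ?lee_fin//= scaleN1r.
rewrite (_ : s t - s' t = (f t - s' t) - (f t - s t)).
  by rewrite addrC; exact: ler_normB.
by rewrite opprB addrCA addrAC subrr add0r addrC.
Qed.

Lemma has_bochner_integral_uniq f x y :
  has_bochner_integral D f x -> has_bochner_integral D f y -> x = y.
Proof.
move=> [mf [s [ss sf sx]]] [_ [s' [ss' sf' sy]]].
have H0 : (dist f (s n) + dist f (s' n))%E @[n --> \oo] --> 0%E.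
  by rewrite -[0%E]adde0; exact: cvgeD.
have H1 : (`|simple_integral D (s n) - simple_integral D (s' n)|)%:E
    @[n --> \oo] --> (`|x - y|)%:E.
  by apply: cvg_EFin; [exact: nearW|apply: cvg_norm; exact: cvgB].
have := lee_cvg_to H1 H0; rewrite lee_fin => H.
apply/eqP; rewrite -subr_eq0 -normr_le0; apply: H; apply: nearW => n.
exact: simple_integral_dist.
Qed.

Lemma bochner_integralE f x :
  has_bochner_integral D f x -> bochner_integral D f = x.
Proof.
move=> fx; apply: xget_subset1 => // a b /= fa fb.
exact: has_bochner_integral_uniq fa fb.
Qed.

Lemma bochner_integralP f : bochner_integrable D f ->
  has_bochner_integral D f (bochner_integral D f).
Proof. by move=> [x fx]; rewrite (bochner_integralE fx). Qed.

Lemma has_bochner_integral_ae f g x :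
  {ae mu, forall t, D t -> f t = g t} ->
  has_bochner_integral D f x -> has_bochner_integral D g x.
Proof.
move=> fg [mf [s [ss sf sx]]]; split; first exact: ae_strongly_measurable_ae mf.
exists s; split => //; rewrite (_ : (fun n => dist g (s n)) = (fun n => dist f (s n)))//.
apply/funext => n; apply: ge0_ae_eq_integralW.
- by move=> t _; rewrite lee_fin.
- by move=> t _; rewrite lee_fin.
- by apply: filterS fg => t H Dt; rewrite H.
Qed.

Lemma has_bochner_integral_simple s : simple borel_sets D s ->
  has_bochner_integral D s (simple_integral D s).
Proof.
move=> ss; split.
  by exists s; split; [exact: simple_strongly_measurable|exact: aeW].
exists (fun=> s); split => //; last exact: cvg_cst.
rewrite (_ : (fun _ => _) = (fun=> 0%E)); first exact: cvg_cst.
by apply/funext => n; apply: integral0_eq => t _; rewrite subrr normr0.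
Qed.

Lemma has_bochner_integralD f g x y :
  has_bochner_integral D f x -> has_bochner_integral D g y ->
  has_bochner_integral D (f \+ g) (x + y).
Proof.
move=> [mf [s [ss sf sx]]] [mg [s' [ss' sg sy]]].
split; first exact: ae_strongly_measurableD.
exists (fun n => s n \+ s' n); split.
- by move=> n; exact: (simple_comp2 (fun x y => x + y)).
- apply: (@squeeze_cvge _ _ _ _ (fun=> 0%E) _
      (fun n => dist f (s n) + dist g (s' n))%E).
  + apply: nearW => n; rewrite dist_ge0 /=.
    rewrite -ge0_integralD_ae//; last 2 first.
    * exact: ae_strongly_measurable_sub.
    * exact: ae_strongly_measurable_sub.
    apply: ge0_le_integralW => t _; rewrite ?lee_fin//=.
    by rewrite opprD addrACA ler_normD.
  + exact: cvg_cst.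
  + by rewrite -[X in _ --> X]adde0; exact: cvgeD.
- under eq_fun do rewrite simple_integralD//; exact: cvgD.
Qed.

Lemma has_bochner_integralZ k f x : has_bochner_integral D f x ->
  has_bochner_integral D (fun t => k *: f t) (k *: x).
Proof.
move=> [mf [s [ss sf sx]]]; split.
  by apply: (ae_strongly_measurableZ (u := fun=> k)) => //; exact: simple_cst.
exists (fun n t => k *: s n t); split.
- by move=> n; exact: (simple_comp (fun x : X => k *: x)).
- rewrite (_ : (fun n => _) = (fun n => (`|k|)%:E * dist f (s n))%E); last first.
    apply/funext => n; have [g mg [g0 fg]] := ae_strongly_measurable_sub mf (ss n).
    rewrite (ge0_ae_eq_integralW _ g0 fg)//.
    rewrite -ge0_integralZl_EFin//; apply: ge0_ae_eq_integralW => //.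
    + by move=> t Dt; rewrite mule_ge0 ?lee_fin// g0.
    + by apply: filterS fg => t H Dt; rewrite -H// -scalerBr normrZ.
  by rewrite -[X in _ --> X](mule0 (`|k|)%:E); exact: cvgeZl.
- by under eq_fun do rewrite simple_integralZ//; exact: cvgZr.
Qed.

Lemma has_bochner_integral0 : has_bochner_integral D (fun=> 0 : X) 0.
Proof.
have := has_bochner_integral_simple (simple_cst (0 : X) mD).
rewrite (simple_integralE mD fD (K := [set 0]))//; last 2 first.
- by move=> _ [t _ <-].
- exact: simple_cst.
by rewrite fsbig_set1 scaler0.
Qed.

Lemma has_bochner_integral_sum (I : Type) (r : seq I) (P : pred I)
    (f : I -> R -> X) (x : I -> X) :
  (forall i, P i -> has_bochner_integral D (f i) (x i)) ->
  has_bochner_integral D (fun t => \sum_(i <- r | P i) f i t)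
    (\sum_(i <- r | P i) x i).
Proof.
move=> fx; elim: r => [|i r IH].
  rewrite big_nil; under eq_fun do rewrite big_nil.
  exact: has_bochner_integral0.
rewrite big_cons; under eq_fun do rewrite big_cons.
by case: ifPn => // Pi; apply: has_bochner_integralD => //; exact: fx.
Qed.

Lemma norm_bochner_integral f x : has_bochner_integral D f x ->
  ((`|x|)%:E <= \int[mu]_(t in D) (`|f t|)%:E)%E.
Proof.
move=> [mf [s [ss sf sx]]].
have ae0 : ae_measurable_ge0 mu D (fun t => (`|f t|)%:E).
  have := ae_strongly_measurable_sub mf (simple_cst 0 mD).
  by under eq_fun do rewrite subr0.
have H0 : (\int[mu]_(t in D) (`|f t|)%:E + dist f (s n))%E @[n --> \oo] -->
    (\int[mu]_(t in D) (`|f t|)%:E)%E.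
  rewrite -[X in _ --> X]adde0; apply: cvgeD => //; last exact: cvg_cst.
  by rewrite fin_num_adde_defl.
have H1 : (`|simple_integral D (s n)|)%:E @[n --> \oo] --> (`|x|)%:E.
  by apply: cvg_EFin; [exact: nearW|exact: cvg_norm].
apply: lee_cvg_to H1 H0 _; apply: nearW => n.
apply: le_trans (norm_simple_integral mD fD (ss n)) _.
rewrite -ge0_integralD_ae//; last exact: ae_strongly_measurable_sub.
apply: ge0_le_integralW => t _; rewrite ?lee_fin//=.
rewrite -[s n t in leLHS](subKr (f t)).
exact: ler_normB.
Qed.

(** Approximating simple functions [s n] need not converge in mean, so they are
    first cut off to 0 where [`|s n t| > 2 * `|f t|].  The result still converges
    pointwise (where [f] vanishes it is 0), and its distance to [f] is at most
    [3 * `|f t|], so dominated convergence applies; completeness of [X] then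
    gives the limit of the integrals. *)
Lemma strongly_measurable_integrable f : strongly_measurable borel_sets D f ->
  (\int[mu]_(t in D) (`|f t|)%:E < +oo)%E -> bochner_integrable D f.
Proof.
move=> mf foo; have [s [ss sf]] := mf.
pose A n : set (measurableTypeR R) := D `&` [set t | `|s n t| <= 2 * `|f t|].
have mN := measurable_fun_norm mf.
have mA n : measurable (A n).
  apply: measurable_fun_le => //.
    exact: (measurable_fun_simple (fun x : X => `|x|)).
  by apply: measurable_funM => //; exact: measurable_cst.
have AD n : A n `<=` D by exact: subIsetl.
pose s' n t := \1_(A n) t *: s n t.
have ss' n : simple borel_sets D (s' n).
  by apply: simple_restrict => //; apply: simpleS (ss n).
have bnd n t : D t -> `|f t - s' n t| <= 3 * `|f t|.
  move=> Dt; apply: le_trans (ler_normB _ _) _.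
  rewrite (_ : 3 * `|f t| = `|f t| + 2 * `|f t|); last first.
    by rewrite -[X in X + _]mul1r -mulrDl; congr (_ * _); rewrite -natr1 addrC.
  rewrite lerD2l /s' indicE; have [/set_mem[_ //]|_] := boolP (t \in A n).
    by rewrite scale1r.
  by rewrite scale0r normr0 mulr_ge0.
have cvg' t : D t -> (`|f t - s' n t|)%:E @[n --> \oo] --> 0%E.
  move=> Dt; apply: cvg_EFin; first exact: nearW.
  rewrite -(normr0 X) -(subrr (f t)); apply: cvg_norm; apply: cvgB; first exact: cvg_cst.
  have [f0|f0] := eqVneq (f t) 0.
    rewrite f0 (_ : s'^~ t = fun=> 0); first exact: cvg_cst.
    apply/funext => n; apply/eqP; have := bnd n t Dt.
    by rewrite f0 normr0 mulr0 sub0r normrN normr_le0.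
  apply: cvg_trans (sf t Dt); apply: near_eq_cvg.
  have /cvgrPdist_lt/(_ `|f t|) := sf t Dt.
  rewrite normr_gt0 => /(_ f0); apply: filterS => n /ltW h.
  rewrite /s' indicE mem_set ?scale1r//; split => //=.
  rewrite mulr_natl mulr2n -lerBlDl; apply: le_trans h.
  by rewrite distrC; exact: lerB_dist.
have dcvg : dist f (s' n) @[n --> \oo] --> 0%E.
  rewrite -[X in _ --> X](@integral0 _ _ _ mu D).
  apply: (@dominated_cvg _ _ _ mu D mD _ _ (fun t => (3 * `|f t|)%:E)) => //.
  - by move=> n; apply/measurable_EFinP; exact: measurable_fun_norm_sub.
  - apply/integrableP; split.
      by apply/measurable_EFinP; apply: measurable_funM => //; exact: measurable_cst.
    under eq_integral do rewrite gee0_abs ?lee_fin ?mulr_ge0// EFinM.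
    rewrite ge0_integralZl_EFin//; last exact/measurable_EFinP.
    by rewrite lte_mul_pinfty.
  - by move=> n t Dt; rewrite gee0_abs ?lee_fin// bnd.
have mfa : ae_strongly_measurable D f by exists f; split => //; exact: aeW.
suff [x sx] : exists x, simple_integral D (s' n) @[n --> \oo] --> x.
  by exists x; split => //; exists s'.
apply/cvg_ex/cauchy_cvgP/cauchy_exP => e e0.
have : \forall n \near \oo, (dist f (s' n) < (e / 2)%:E)%E.
  have [fin /cvgr_lt lt] := iffLR (fine_cvgP _ _) dcvg.
  have e2 : 0 < e / 2 by rewrite divr_gt0.
  by apply: filterS2 fin (lt _ e2) => n fn; rewrite /= -lte_fin fineK.
move=> [N _ HN]; exists (simple_integral D (s' N)); exists N => // n /= Nn.
rewrite -ball_normE /= -lte_fin; apply: le_lt_trans (simple_integral_dist mfa (ss' N) (ss' n)) _.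
by rewrite (splitr e) EFinD; apply: lteD; apply: HN => /=.
Qed.

End bochner_integral.

Lemma has_bochner_integral_restrict (R : realType) (X : completeNormedModType R)
    (D A : set (measurableTypeR R)) (f : R -> X) (x : X) :
  measurable D -> (lebesgue_measure D < +oo)%E -> measurable A -> A `<=` D ->
  has_bochner_integral A f x ->
  has_bochner_integral D (fun t => \1_A t *: f t) x.
Proof.
move=> mD fD mA AD [mf [s [ss sf sx]]].
split; first exact: ae_strongly_measurable_restrict.
exists (fun n t => \1_A t *: s n t); split.
- by move=> n; exact: simple_restrict.
- rewrite (_ : (fun n => _) = (fun n => \int[lebesgue_measure]_(t in A)
    (`|f t - s n t|)%:E)%E)//.
  apply/funext => n; rewrite -[in RHS](setIidr AD) integral_mkcondr.
  apply: eq_integral => t _; rewrite /patch -scalerBr normrZ indicE.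
  by case: (t \in A); rewrite ?normr1 ?normr0 ?mul1r ?mul0r.
- by under eq_fun do rewrite simple_integral_restrict//.
Qed.

(** * Products along binary digits *)

Section binary_products.
Variable A : comPzRingType.
Implicit Types (F : nat -> A) (i k m n : nat).

(** [walsh i t] is this product for the factors [rademacher q t]; leaving the
    factors abstract makes the identities below available for the products
    [rademacher q t * rademacher q s] as well. *)
Definition binary_prod F i : A := \prod_(q < i) F q ^+ odd (i %/ 2 ^ q)%N.

(** Digits beyond the length of [i] are 0, so the number of factors only has to
    be large enough. *)
Lemma binary_prodE F n i : (i < 2 ^ n)%N ->
  binary_prod F i = \prod_(q < n) F q ^+ odd (i %/ 2 ^ q)%N.
Proof.
move=> ilt.
have E j : (i < 2 ^ j)%N -> (j <= maxn i n)%N ->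
   \prod_(q < maxn i n) F q ^+ odd (i %/ 2 ^ q)%N =
   \prod_(q < j) F q ^+ odd (i %/ 2 ^ q)%N.
  move=> ij jm; rewrite [RHS](big_ord_widen (maxn i n)
    (fun q => F q ^+ odd (i %/ 2 ^ q)%N))// [RHS]big_mkcond/=.
  apply: eq_bigr => q _; case: ltnP => // jq.
  by rewrite divn_small ?expr0// (leq_trans ij)// leq_exp2l.
have Ei := E i (ltn_expl i (ltnSn 1)) (leq_maxl i n).
by rewrite -(E n ilt (leq_maxr i n)) Ei.
Qed.

Lemma binary_prod_pow2D F n i : (i < 2 ^ n)%N ->
  binary_prod F (2 ^ n + i) = F n * binary_prod F i.
Proof.
move=> ilt; rewrite (@binary_prodE _ n.+1); last by rewrite expnS; lia.
rewrite (binary_prodE _ ilt) big_ord_recr/= mulrC.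
rewrite divnDl// divnn expn_gt0/= divn_small// addn0 expr1.
congr (_ * _); apply: eq_bigr => q _.
have qn := ltn_ord q.
rewrite divnDl ?dvdn_exp2l 1?ltnW// -expnB// 1?ltnW// oddD oddX/=.
by rewrite subn_eq0 leqNgt qn.
Qed.

Lemma sum_binary_prod F n :
  \sum_(i < 2 ^ n) binary_prod F i = \prod_(q < n) (1 + F q).
Proof.
elim: n => [|n IH]; first by rewrite big_ord1 /binary_prod !big_ord0.
rewrite expnS mul2n -addnn big_split_ord/= big_ord_recr/= -IH mulrDr mulr1.
congr (_ + _); rewrite mulrC big_distrr/=; apply: eq_bigr => i _.
by rewrite binary_prod_pow2D.
Qed.

Section involutions.
Variable F : nat -> A.
Hypothesis F2 : forall q, F q * F q = 1.

Lemma binary_prod_sqr i : binary_prod F i * binary_prod F i = 1.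
Proof.
rewrite -big_split/= big1// => q _.
by case: odd; rewrite ?expr0 ?expr1 ?mulr1.
Qed.

(** [F q * (1 + F q) = 1 + F q] for an involution [F q]. *)
Lemma binary_prod_absorb n i : (i < 2 ^ n)%N ->
  binary_prod F i * \prod_(q < n) (1 + F q) = \prod_(q < n) (1 + F q).
Proof.
move=> ilt; rewrite (binary_prodE _ ilt) -big_split/=; apply: eq_bigr => q _.
by case: odd; rewrite ?expr0 ?mul1r// expr1 mulrDr F2 mulr1 addrC.
Qed.

(** Induction on [n].  If the digit of index [n] of [k < 2 ^ n.+1] is 1, write
    [k = 2 ^ n + j]: the indices below [2 ^ n] contribute the full product, and
    the others contribute [F n] times the sum for [j].  On the right the new
    term is [F n * binary_prod F j * (F n * \prod_(q < n) (1 + F q))], which is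
    the full product because [F n] squares to 1 and [binary_prod F j] is
    absorbed. *)
Lemma sum_binary_prod_digits n k : (k < 2 ^ n)%N ->
  \sum_(i < k) binary_prod F i =
  binary_prod F k * \sum_(m < n | odd (k %/ 2 ^ m)%N) F m * \prod_(q < m) (1 + F q).
Proof.
elim: n k => [|n IH] k klt.
  by move: klt; rewrite expn0 ltnS leqn0 => /eqP ->; rewrite !big_ord0 mulr0.
rewrite [in RHS]big_mkcond big_ord_recr -big_mkcond/=.
have [kn|kn] := ltnP k (2 ^ n)%N.
  by rewrite (divn_small kn)/= addr0; exact: IH.
have [j jlt ->] : exists2 j, (j < 2 ^ n)%N & k = (2 ^ n + j)%N.
  by exists (k - 2 ^ n)%N; move: klt; rewrite expnS; lia.
rewrite divnDl// divnn expn_gt0/= divn_small// binary_prod_pow2D//.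
rewrite big_split_ord/= sum_binary_prod.
under [X in _ + X]eq_bigr => i _.
  rewrite binary_prod_pow2D; last by rewrite (ltn_trans (ltn_ord i)).
  over.
rewrite -mulr_sumr (IH _ jlt) mulrDr addrC; congr (_ + _).
  rewrite -!mulrA; congr (_ * (_ * _)); apply: eq_bigl => q.
  have qn := ltn_ord q.
  rewrite divnDl ?dvdn_exp2l 1?ltnW// -expnB// 1?ltnW// oddD oddX/=.
  by rewrite subn_eq0 leqNgt qn.
by rewrite mulrACA F2 mul1r binary_prod_absorb.
Qed.

End involutions.
End binary_products.

Lemma binary_prodM (A : comPzRingType) (F G : nat -> A) i :
  binary_prod F i * binary_prod G i = binary_prod (fun q => F q * G q) i.
Proof. by rewrite -big_split/=; apply: eq_bigr => q _; rewrite exprMn. Qed.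

Lemma exists_binary_digits (p : nat) (b : pred nat) :
  exists2 k, (k < 2 ^ p)%N & forall m, (m < p)%N -> odd (k %/ 2 ^ m)%N = b m.
Proof.
elim: p => [|p [k kp kb]]; first by exists 0%N.
case bp : (b p); [exists (2 ^ p + k)%N|exists k].
- by rewrite expnS; lia.
- move=> m; rewrite ltnS leq_eqVlt => /predU1P[->|mp].
    by rewrite divnDl// divnn expn_gt0/= divn_small.
  rewrite divnDl ?dvdn_exp2l 1?ltnW// -expnB// 1?ltnW// oddD oddX/=.
  by rewrite subn_eq0 leqNgt mp/= kb.
- by rewrite expnS; lia.
- move=> m; rewrite ltnS leq_eqVlt => /predU1P[->|mp]; last exact: kb.
  by rewrite divn_small.
Qed.

(** * Dyadic cells and the dyadic filtration *)

Section dyadic_cells.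
Context {R : realType}.
Local Notation mu := (@lebesgue_measure R).
Local Notation U := (`[0%R, 1%R[%classic : set (measurableTypeR R)).
Implicit Types (s t : R) (n m q i k : nat).

(** Comparing integer parts, rather than interval indices, makes refinement
    transparent: passing from level [n] to [n.+1] means comparing one more
    Rademacher sign ([same_cellS]). *)
Definition same_cell n s t := Num.floor (2 ^+ n * s) == Num.floor (2 ^+ n * t).

(** The next binary digit of a real number is read off from the sign of the
    first Rademacher function. *)
Lemma floor_double (x : R) :
  Num.floor (2 * x) = 2 * Num.floor x + (rademacher1 x == -1)%:Z.
Proof.
apply: floor_def; rewrite /rademacher1.
have := floor_itv x; rewrite !intrD !intrM.
set f := (Num.floor x)%:~R : R; move=> /andP[].
have N1 : (1 == -1 :> R) = false by apply: gt_eqF; lra.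
case: ifPn => h.
  by rewrite N1/=; lra.
rewrite -leNgt in h.
by rewrite eqxx/=; lra.
Qed.

Lemma rademacher_pm n t : rademacher n t = 1 \/ rademacher n t = -1.
Proof. by rewrite /rademacher /rademacher1; case: ifP; [left|right]. Qed.

Lemma rademacher_sqr n t : rademacher n t * rademacher n t = 1.
Proof. by case: (rademacher_pm n t) => ->; rewrite ?mulr1// mulrNN mulr1. Qed.

Lemma same_cellS n s t :
  same_cell n.+1 s t = same_cell n s t && (rademacher n s == rademacher n t).
Proof.
rewrite /same_cell !exprS -!mulrA !floor_double -!/(rademacher n _).
have N1 : (1 == -1 :> R) = false by apply: gt_eqF; lra.
have N2 : (-1 == 1 :> R) = false by apply: lt_eqF; lra.
case: (rademacher_pm n s) => ->; case: (rademacher_pm n t) => ->;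
  rewrite ?N1 ?N2 ?eqxx/= ?andbT ?andbF; lia.
Qed.

Lemma same_cellW n m s t : (n <= m)%N -> same_cell m s t -> same_cell n s t.
Proof.
move=> /subnK <-; elim: (m - n)%N => // d IH.
by rewrite addSn same_cellS => /andP[/IH].
Qed.

Lemma same_cell0 s t : U s -> U t -> same_cell 0 s t.
Proof.
have z x : U x -> Num.floor (2 ^+ 0 * x) = 0.
  by rewrite /= in_itv/= mul1r => /andP[x0 x1]; apply: floor_def; rewrite x0.
by move=> Us Ut; rewrite /same_cell !z.
Qed.

(** The kernel of the conditional expectation onto the level [n]: the factor of
    index [q] is 2 or 0 according to whether the Rademacher signs of [s] and [t]
    agree. *)
Lemma prod_rademacher n s t : U s -> U t ->
  \prod_(q < n) (1 + rademacher q t * rademacher q s) =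
  2 ^+ n * (same_cell n s t)%:R.
Proof.
move=> Us Ut; elim: n => [|n IH]; first by rewrite big_ord0 same_cell0// mulr1.
rewrite big_ord_recr/= IH same_cellS exprSr.
have N1 : (1 == -1 :> R) = false by apply: gt_eqF; lra.
have N2 : (-1 == 1 :> R) = false by apply: lt_eqF; lra.
case: (rademacher_pm n s) => ->; case: (rademacher_pm n t) => ->;
  rewrite ?N1 ?N2 ?eqxx/= ?andbT ?andbF ?mulr0n;
  set b := _%:R; ring.
Qed.

Lemma walshE i t : walsh i t = binary_prod (rademacher^~ t) i.
Proof. by []. Qed.

Lemma walsh_sqr i t : walsh i t * walsh i t = 1.
Proof. by rewrite !walshE binary_prod_sqr// => q; exact: rademacher_sqr. Qed.

Lemma norm_walsh i t : `|walsh i t| = 1.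
Proof. by apply/eqP; rewrite -sqrp_eq1// -normrX expr2 walsh_sqr normr1. Qed.

Definition dyadic_step (Z : Type) n (h : R -> Z) :=
  forall s t, U s -> U t -> same_cell n s t -> h s = h t.

Lemma dyadic_stepW Z n m (h : R -> Z) : (n <= m)%N ->
  dyadic_step n h -> dyadic_step m h.
Proof. by move=> nm hh s t Us Ut /(same_cellW nm); exact: hh. Qed.

Lemma rademacher_step q n : (q < n)%N -> dyadic_step n (rademacher q).
Proof.
by move=> qn s t _ _ /(same_cellW qn); rewrite same_cellS => /andP[_ /eqP].
Qed.

Lemma walsh_step n i : (i < 2 ^ n)%N -> dyadic_step n (walsh i).
Proof.
move=> ilt s t Us Ut st; rewrite !walshE !(binary_prodE _ ilt).
by apply: eq_bigr => q _; rewrite (@rademacher_step q n _ s t).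
Qed.

Lemma dyadic_intervalP n k t :
  dyadic_interval n k t <-> Num.floor (2 ^+ n * t) = k%:Z.
Proof.
have p0 : 0 < 2 ^+ n :> R by rewrite exprn_gt0.
rewrite /dyadic_interval /= in_itv/= ler_pdivrMr// ltr_pdivlMr//.
rewrite ![t * _]mulrC -[k.+1%:R]natr1.
split=> [h|/eqP]; first by apply/eqP; rewrite floor_eq intrD; exact: h.
by rewrite floor_eq intrD; exact.
Qed.

Lemma dyadic_interval_sub n k : (k < 2 ^ n)%N ->
  (dyadic_interval n k : set R) `<=` U.
Proof.
have p0 : 0 < 2 ^+ n :> R by rewrite exprn_gt0.
move=> kn t; rewrite /dyadic_interval /= !in_itv/= => /andP[kt tk].
apply/andP; split; first by apply: le_trans kt; rewrite divr_ge0 ?ler0n// ltW.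
by apply: lt_le_trans tk _; rewrite ler_pdivrMr// mul1r -natrX ler_nat.
Qed.

Lemma dyadic_interval_ex n t : U t ->
  exists2 k, (k < 2 ^ n)%N & dyadic_interval n k t.
Proof.
have p0 : 0 < 2 ^+ n :> R by rewrite exprn_gt0.
rewrite /= in_itv/= => /andP[t0 t1].
have f0 : 0 <= Num.floor (2 ^+ n * t) by rewrite floor_ge0 mulr_ge0// ltW.
have [k fk] : exists k : nat, Num.floor (2 ^+ n * t) = k%:Z.
  by exists `|Num.floor (2 ^+ n * t)|%N; rewrite gez0_abs.
exists k; last exact/dyadic_intervalP.
rewrite -(ltr_nat R) natrX.
apply: (@le_lt_trans _ _ (2 ^+ n * t)).
  by have /andP[] := floor_itv (2 ^+ n * t); rewrite fk.
by rewrite -[ltRHS]mulr1 ltr_pM2l.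
Qed.

Definition cell n t : set (measurableTypeR R) := [set s | U s /\ same_cell n s t].

Lemma cell_dyadic_interval n k t : (k < 2 ^ n)%N -> dyadic_interval n k t ->
  cell n t = dyadic_interval n k.
Proof.
move=> kn /[dup] kt /dyadic_intervalP ft; apply/seteqP; split => s.
  by move=> [_ /eqP]; rewrite ft => /dyadic_intervalP.
move=> ks; split; first exact: dyadic_interval_sub ks.
by move/dyadic_intervalP : ks; rewrite /same_cell ft => ->.
Qed.

Lemma measurable_cell n t : U t -> measurable (cell n t).
Proof.
by move=> /(dyadic_interval_ex n)[k kn kt]; rewrite (cell_dyadic_interval kn kt);
  exact: measurable_itv.
Qed.

Lemma measure_cell n t : U t -> mu (cell n t) = (2 ^- n)%:E.
Proof.
have p0 : 0 < 2 ^+ n :> R by rewrite exprn_gt0.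
move=> /(dyadic_interval_ex n)[k kn kt]; rewrite (cell_dyadic_interval kn kt).
rewrite lebesgue_measure_itv/= lte_fin ltr_pM2r ?invr_gt0// ltr_nat ltnSn.
by rewrite -EFinB -mulrBl -[k.+1%:R]natr1 addrAC subrr add0r mul1r.
Qed.

Definition saturated n (B : set R) :=
  forall s t, U s -> U t -> same_cell n s t -> B s -> B t.

Lemma same_cellC n s t : same_cell n s t = same_cell n t s.
Proof. by rewrite /same_cell eq_sym. Qed.

(** The unions of dyadic intervals of level [n] form a sigma-algebra containing
    the generators; conversely such a set is the union of the at most [2 ^ n]
    intervals that it contains. *)
Lemma dyadic_algebraP n (B : set R) :
  dyadic_algebra n B <-> B `<=` U /\ saturated n B.
Proof.
split=> [|[BU satB]].
  pose G (B : set R) := B `<=` U /\ saturated n B.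
  apply: (smallest_sub (X := G)) => [|_ [k kn <-]].
    split=> [|A [AU sA]|A hA].
    - by split.
    - split=> [x []//|s t Us Ut st [_ nAs]]; split => // At.
      by apply: nAs; apply: sA At => //; rewrite same_cellC.
    - split=> [x [k _]|s t Us Ut st [k _ Aks]]; first by case: (hA k) => + _; apply.
      by exists k => //; case: (hA k) => _ /(_ s t); apply.
  split; first exact: dyadic_interval_sub.
  move=> s t Us Ut /eqP st /dyadic_intervalP ks; apply/dyadic_intervalP.
  by rewrite -st.
pose C k : set R := [set t | [/\ (k < 2 ^ n)%N, dyadic_interval n k t & B t]].
have -> : B = \bigcup_k C k.
  apply/seteqP; split=> [t Bt|t [k _ []//]].
  by have [k kn kt] := dyadic_interval_ex n (BU _ Bt); exists k.
apply: sigma_algebra_bigcup => k.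
have [[kn [t kt Bt]]|] := pselect ((k < 2 ^ n)%N /\ exists2 t, dyadic_interval n k t & B t).
  have -> : C k = dyadic_interval n k.
    apply/seteqP; split=> [x [_ kx _] //|x kx]; split => //.
    apply: (satB t x) => //; [exact: BU|exact: dyadic_interval_sub kx|].
    by move: kt kx; rewrite /same_cell => /dyadic_intervalP -> /dyadic_intervalP ->.
  by apply: sub_sigma_algebra; exists k.
move=> H; have -> : C k = set0.
  by apply/seteqP; split => // x [kn kx Bx]; apply: H; split => //; exists x.
exact: sigma_algebra0.
Qed.

Lemma dyadic_algebra_measurable n (B : set R) : dyadic_algebra n B ->
  measurable (B : set (measurableTypeR R)).
Proof.
apply: smallest_sub => [|_ [k kn <-]]; last exact: measurable_itv.
split=> [|A mA|A mA].
- exact: measurable0.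
- by apply: measurableD => //; exact: measurable_itv.
- exact: bigcupT_measurable.
Qed.

Lemma dyadic_algebra_cell n t : U t -> dyadic_algebra n (cell n t).
Proof.
move=> Ut; apply/dyadic_algebraP; split=> [s []//|s s' Us Us' ss' [_ st]].
by split => //; move: ss' st; rewrite /same_cell => /eqP <-.
Qed.

Lemma dyadic_algebraW n m (B : set R) : (n <= m)%N ->
  dyadic_algebra n B -> dyadic_algebra m B.
Proof.
move=> nm /dyadic_algebraP[BU sB]; apply/dyadic_algebraP; split => //.
by move=> s t Us Ut /(same_cellW nm); exact: sB.
Qed.

Section vector_valued.
Implicit Type X : completeNormedModType R.

Lemma dyadic_step_simple X n (h : R -> X) :
  dyadic_step n h -> simple (dyadic_algebra n) U h.
Proof.
move=> sh; split.
  apply: (@sub_finite_set _ _ ((fun k => h (k%:R / 2 ^+ n)) @` `I_(2 ^ n))).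
    move=> _ [t Ut <-]; have [k kn kt] := dyadic_interval_ex n Ut.
    exists k => //; have kk : dyadic_interval n k (k%:R / 2 ^+ n : R).
      by rewrite /dyadic_interval/= in_itv/= lexx/= ltr_pM2r ?invr_gt0 ?exprn_gt0// ltr_nat.
    apply: sh => //; first exact: dyadic_interval_sub kk.
    by move: kt kk; rewrite /same_cell => /dyadic_intervalP -> /dyadic_intervalP ->.
  by apply: finite_image; exact: finite_II.
move=> x; apply/dyadic_algebraP; split=> [t []//|s t Us Ut st [_ /= <-]].
by split => //=; apply: sh => //; rewrite same_cellC.
Qed.

(** Measurable simple functions do not separate points of a cell, and neither do
    their pointwise limits. *)
Lemma strongly_measurable_dyadic_step X n (h : R -> X) :
  strongly_measurable (dyadic_algebra n) U h -> dyadic_step n h.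
Proof.
move=> [v [sv vh]] s t Us Ut st.
have E k : v k s = v k t.
  have /dyadic_algebraP[_ /(_ s t Us Ut st)] := proj2 (sv k) (v k s).
  by move=> /(_ (conj Us erefl)) [_ /= ->].
have Ev : (fun k => v k s) = (fun k => v k t) by exact/funext.
have hs := vh s Us; rewrite Ev in hs.
exact: (cvg_unique (@norm_hausdorff _ _) hs (vh t Ut)).
Qed.

Lemma borel_simple_dyadic_step X n (h : R -> X) :
  dyadic_step n h -> simple borel_sets U h.
Proof.
move=> /dyadic_step_simple[fh mh]; split => // x.
exact: dyadic_algebra_measurable (mh x).
Qed.

End vector_valued.
End dyadic_cells.

(** * Walsh sums as kernel operators on the unit interval *)

Section unit_interval.
Context {R : realType}.
Local Notation mu := (@lebesgue_measure R).
Local Notation U := (`[0%R, 1%R[%classic : set (measurableTypeR R)).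
Local Notation I := (`[0%R, 1%R]%classic : set (measurableTypeR R)).
Implicit Types X : completeNormedModType R.

Lemma measurable_unit : measurable I.
Proof. exact: measurable_itv. Qed.

Lemma measurable_unit_co : measurable U.
Proof. exact: measurable_itv. Qed.

Lemma measure_unit : mu I = 1%E.
Proof. by rewrite lebesgue_measure_itv/= lte_fin ltr01 oppr0 adde0. Qed.

Lemma measure_unit_fin : (mu I < +oo)%E.
Proof. by rewrite measure_unit ltry. Qed.

Lemma unit_coW : U `<=` I.
Proof. by move=> t /=; rewrite !in_itv/= => /andP[-> /ltW]. Qed.

Lemma measure_unit_co_fin : (mu U < +oo)%E.
Proof. by rewrite lebesgue_measure_itv/= lte_fin ltr01 oppr0 adde0 ltry. Qed.

(** The two unit intervals in use differ by the point 1, which has measure 0. *)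
Lemma ae_unit (P : R -> Prop) :
  (forall t, U t -> P t) -> {ae mu, forall t, I t -> P t}.
Proof.
move=> UP; exists [set 1]; split; first exact: measurable_set1.
  exact: lebesgue_measure_set1.
move=> t /= nP; apply: contrapT => t1; apply: nP; rewrite /= in_itv/= => /andP[t0 lt1].
by apply: UP; rewrite /= in_itv/= t0 lt_neqAle lt1 andbT; apply/eqP.
Qed.

Lemma integral_unit_co (f : R -> \bar R) : (forall t, 0 <= f t)%E ->
  (\int[mu]_(t in U) f t = \int[mu]_(t in I) f t)%E.
Proof.
move=> f0; rewrite -[U in LHS](setIidr unit_coW) integral_mkcondr.
apply: ge0_ae_eq_integralW => [t _|t _|].
- by rewrite /patch; case: ifP.
- exact: f0.
apply: (ae_unit (P := fun t => (f \_ U) t = f t)) => t Ut.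
by rewrite /patch mem_set.
Qed.

Lemma simple_step X n (h : R -> X) : dyadic_step n h ->
  simple borel_sets I (fun t => \1_U t *: h t).
Proof.
move=> sh; apply: simple_restrict; [exact: measurable_unit|
  exact: measurable_unit_co|exact: unit_coW|exact: borel_simple_dyadic_step sh].
Qed.

Lemma restrict_unit_ae X (h : R -> X) :
  {ae mu, forall t, I t -> \1_U t *: h t = h t}.
Proof. by apply: ae_unit => t Ut; rewrite indicE mem_set// scale1r. Qed.

Lemma ae_strongly_measurable_step X n (h : R -> X) : dyadic_step n h ->
  ae_strongly_measurable I h.
Proof.
move=> sh; apply: ae_strongly_measurable_ae (restrict_unit_ae h) _.
exists (fun t => \1_U t *: h t); split; last exact: aeW.
exact: simple_strongly_measurable (simple_step sh).
Qed.

Lemma has_bochner_integral_unit X (f g : R -> X) x :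
  (forall t, U t -> f t = g t) ->
  has_bochner_integral I f x -> has_bochner_integral I g x.
Proof. by move=> fg; apply: has_bochner_integral_ae; exact: ae_unit. Qed.

(** Walsh coefficients default to 0 when the integral does not exist; this is the
    condition under which they have their intended meaning. *)
Definition walsh_integrable X (f : R -> X) := forall i,
  has_bochner_integral I (fun t => walsh i t *: f t) (walsh_coef f i).

Lemma l2norm_fin X (D : set R) (f : R -> X) :
  (l2norm D f < +oo)%E = (\int[mu]_(t in D) (`|f t| ^+ 2)%:E < +oo)%E.
Proof.
rewrite -!ge0_fin_numE ?sqrte_fin_num// ?sqrte_ge0//;
  by apply: integral_ge0 => t _; rewrite lee_fin exprn_ge0.
Qed.

Lemma mem_L2_walsh X k (f : R -> X) :
  mem_L2 I f -> mem_L2 I (fun t => walsh k t *: f t).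
Proof.
move=> [mf foo]; split.
  apply: (@ae_strongly_measurable_ae _ _ _ (fun t => (\1_U t *: (walsh k t : R^o)) *: f t)).
    by apply: ae_unit => t Ut; rewrite indicE mem_set// scale1r.
  apply: ae_strongly_measurableZ => //.
  apply: (@simple_step R^o k); apply: walsh_step; exact: ltn_expl.
move: foo; rewrite !l2norm_fin => foo.
by under eq_integral do rewrite normrZ norm_walsh mul1r.
Qed.

(** [`|f t|] is at most [1 + `|f t| ^+ 2], and the unit interval has finite
    measure. *)
Lemma mem_L2_integrable X (f : R -> X) : mem_L2 I f -> bochner_integrable I f.
Proof.
move=> [[g [mg fg]]]; rewrite l2norm_fin => foo.
have goo : (\int[mu]_(t in I) (`|g t| ^+ 2)%:E < +oo)%E.
  apply: (le_lt_trans _ foo); apply: ge0_ae_le_integralW.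
  - by move=> t _; rewrite lee_fin exprn_ge0.
  - by move=> t _; rewrite lee_fin exprn_ge0.
  - by apply: filterS fg => t H It; rewrite H.
have mN : measurable_fun I (fun t => `|g t|) := measurable_fun_norm mg.
have [x gx] : bochner_integrable I g.
  apply: (strongly_measurable_integrable measurable_unit measure_unit_fin mg).
  apply: (@le_lt_trans _ _ (\int[mu]_(t in I) (1%:E + (`|g t| ^+ 2)%:E))%E).
    apply: ge0_le_integralW => t _; first by rewrite lee_fin.
    by rewrite -EFinD lee_fin; have := normr_ge0 (g t); nra.
  rewrite (ge0_integralD _ measurable_unit)//; last first.
    by apply/measurable_EFinP; exact: measurable_funX.
  rewrite integral_cst; last exact: measurable_unit.
  by rewrite [X in (1 * X)%E]measure_unit mule1 lte_add_pinfty// ltry.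
by exists x; apply: has_bochner_integral_ae gx; apply: filterS fg => t H It; rewrite H.
Qed.

Lemma mem_L2_walsh_integrable X (f : R -> X) : mem_L2 I f -> walsh_integrable f.
Proof.
move=> fL2 i; apply: bochner_integralP; [exact: measurable_unit|
  exact: measure_unit_fin|].
exact/mem_L2_integrable/mem_L2_walsh.
Qed.

(** Such a function takes finitely many values, whose norms sum to a bound. *)
Lemma mem_L2_step X n (h : R -> X) : dyadic_step n h -> mem_L2 I h.
Proof.
move=> sh; split; first exact: ae_strongly_measurable_step sh.
have [fh _] := dyadic_step_simple sh.
pose B := \sum_(x <- fset_set (h @` U)) `|x|.
have hB t : U t -> `|h t| <= B.
  move=> Ut; rewrite /B (big_rem (h t))/=; last by rewrite in_fset_set// inE; exists t.
  by rewrite lerDl sumr_ge0.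
rewrite l2norm_fin -integral_unit_co; last by move=> t; rewrite lee_fin exprn_ge0.
apply: (@le_lt_trans _ _ (\int[mu]_(t in U) (B ^+ 2)%:E)%E).
  apply: ge0_le_integralW => t Ut; rewrite lee_fin ?exprn_ge0//.
  by rewrite lerXn2r ?nnegrE ?hB// (le_trans _ (hB t Ut)).
rewrite integral_cst; last exact: measurable_unit_co.
apply: lte_mul_pinfty => //; last exact: measure_unit_co_fin.
by rewrite lee_fin exprn_ge0// /B sumr_ge0.
Qed.

Lemma walsh_sum_step X n k (f : R -> X) : (k <= 2 ^ n)%N ->
  dyadic_step n (walsh_sum k f).
Proof.
move=> kn s t Us Ut st; apply: eq_bigr => i _; congr (_ *: _).
by apply: walsh_step st => //; exact: leq_trans (ltn_ord i) kn.
Qed.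

Lemma has_bochner_integral_walsh X (f : R -> X) k (c : nat -> R) :
  walsh_integrable f ->
  has_bochner_integral I (fun s => (\sum_(i < k) c i * walsh i s) *: f s)
    (\sum_(i < k) c i *: walsh_coef f i).
Proof.
move=> wf.
apply: (@has_bochner_integral_unit _ (fun s => \sum_(i < k) c i *: (walsh i s *: f s))).
  by move=> s _; rewrite scaler_suml; apply: eq_bigr => i _; rewrite scalerA.
apply: has_bochner_integral_sum => [||i _].
- exact: measurable_unit.
- exact: measure_unit_fin.
- apply: has_bochner_integralZ; [exact: measurable_unit|exact: measure_unit_fin|exact: wf].
Qed.

(** The Walsh kernels only depend on [t] and [s] through these signs. *)
Definition rademacher_pair (t s : R) (q : nat) : R := rademacher q t * rademacher q s.

Lemma rademacher_pair_sqr t s q : rademacher_pair t s q * rademacher_pair t s q = 1.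
Proof. by rewrite /rademacher_pair mulrACA !rademacher_sqr mulr1. Qed.

Lemma walsh_sum_kernel X (f : R -> X) k t : walsh_integrable f ->
  has_bochner_integral I (fun s => (\sum_(i < k) binary_prod (rademacher_pair t s) i) *: f s)
    (walsh_sum k f t).
Proof.
move=> /(has_bochner_integral_walsh k (walsh^~ t)).
apply: has_bochner_integral_unit => s _; congr (_ *: _).
by apply: eq_bigr => i _; rewrite !walshE binary_prodM.
Qed.

Lemma walsh_sum_pow2_kernel X (f : R -> X) n t : walsh_integrable f ->
  has_bochner_integral I (fun s => (\prod_(q < n) (1 + rademacher_pair t s q)) *: f s)
    (walsh_sum (2 ^ n) f t).
Proof.
move=> /(walsh_sum_kernel (2 ^ n) t).
by apply: has_bochner_integral_unit => s _; rewrite sum_binary_prod.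
Qed.

(** The Walsh sum of length [2 ^ n] is the average of [f] over the cell. *)
Lemma walsh_sum_cell X (f : R -> X) n t : walsh_integrable f -> U t ->
  has_bochner_integral I (fun s => \1_(cell n t) s *: f s)
    (2 ^- n *: walsh_sum (2 ^ n) f t).
Proof.
move=> wf Ut.
have := has_bochner_integralZ measurable_unit measure_unit_fin (2 ^- n)
  (walsh_sum_pow2_kernel n t wf).
apply: has_bochner_integral_unit => s Us.
rewrite prod_rademacher// scalerA mulrA mulVf ?mul1r; last by rewrite expf_neq0// pnatr_eq0.
rewrite indicE; congr ((nat_of_bool _)%:R *: _); apply/idP/idP.
  by move=> st; rewrite inE.
by rewrite inE => -[].
Qed.

(** The martingale form of a Walsh sum.  Both sides are Bochner integrals of [f]
    against a kernel, and the kernels agree by [sum_binary_prod_digits]. *)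
Lemma walsh_sum_digits X (f : R -> X) n k t : walsh_integrable f ->
  walsh_integrable (fun s => walsh k s *: f s) -> (k < 2 ^ n)%N ->
  walsh_sum k f t = walsh k t *: \sum_(m < n | odd (k %/ 2 ^ m)%N)
    (walsh_sum (2 ^ m.+1) (fun s => walsh k s *: f s) t -
     walsh_sum (2 ^ m) (fun s => walsh k s *: f s) t).
Proof.
move=> wf wg kn; set g := (fun s => _) in wg *.
have mI := measurable_unit; have fI := measure_unit_fin.
apply: (has_bochner_integral_uniq mI fI (walsh_sum_kernel k t wf)).
have hm m : has_bochner_integral I (fun s =>
    (rademacher_pair t s m * \prod_(q < m) (1 + rademacher_pair t s q)) *: g s)
    (walsh_sum (2 ^ m.+1) g t - walsh_sum (2 ^ m) g t).
  rewrite -scaleN1r.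
  have := has_bochner_integralD mI fI (walsh_sum_pow2_kernel m.+1 t wg)
    (has_bochner_integralZ mI fI (-1) (walsh_sum_pow2_kernel m t wg)).
  apply: has_bochner_integral_unit => s _.
  have E (y : X) : (\prod_(q < m.+1) (1 + rademacher_pair t s q)) *: y +
      -1 *: ((\prod_(q < m) (1 + rademacher_pair t s q)) *: y) =
      (rademacher_pair t s m * \prod_(q < m) (1 + rademacher_pair t s q)) *: y.
    by rewrite scalerA -scalerDl big_ord_recr/=; congr (_ *: _); ring.
  exact: E.
have := has_bochner_integralZ mI fI (walsh k t) (has_bochner_integral_sum mI fI
  (index_enum 'I_n) (P := fun m : 'I_n => odd (k %/ 2 ^ m)%N) (fun m _ => hm m)).
apply: has_bochner_integral_unit => s _.
rewrite -scaler_suml /g !scalerA; congr (_ *: _).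
rewrite (sum_binary_prod_digits (rademacher_pair_sqr t s) kn) mulrAC; congr (_ * _).
by rewrite !walshE binary_prodM.
Qed.

End unit_interval.

(** * Conditional expectations and dyadic martingales *)

Section conditional_expectation.
Context {R : realType}.
Local Notation mu := (@lebesgue_measure R).
Local Notation U := (`[0%R, 1%R[%classic : set (measurableTypeR R)).
Local Notation I := (`[0%R, 1%R]%classic : set (measurableTypeR R)).
Implicit Types X : completeNormedModType R.

Let mI : measurable I := measurable_unit.
Let fI : (mu I < +oo)%E := measure_unit_fin.

(** Multiplying a fixed vector by scalars is continuous and linear, hence
    commutes with integration. *)
Lemma has_bochner_integral_vector X (x : X) (u : R -> R^o) (a : R^o) :
  has_bochner_integral I u a ->
  has_bochner_integral I (fun t => u t *: x) (a *: x).
Proof.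
move=> [mu' [s [ss su sa]]]; split.
  have [v [[w [sw wv]] uv]] := mu'; exists (fun t => v t *: x); split.
    exists (fun n t => w n t *: x); split => [n|t It].
      exact: (simple_comp (fun k : R^o => k *: x)).
    by apply: cvgZ; [exact: wv|exact: cvg_cst].
  by apply: filterS uv => t H It; rewrite H.
exists (fun n t => s n t *: x); split.
- by move=> n; exact: (simple_comp (fun k : R^o => k *: x)).
- rewrite (_ : (fun n => _) = (fun n => (`|x|)%:E *
     \int[mu]_(t in I) (`|u t - s n t|)%:E)%E); last first.
    apply/funext => n; have [g mg [g0 fg]] := ae_strongly_measurable_sub mu' (ss n).
    rewrite (ge0_ae_eq_integralW _ g0 fg)//.
    rewrite -ge0_integralZl_EFin//; apply: ge0_ae_eq_integralW => //.
    + by move=> t Dt; rewrite mule_ge0 ?lee_fin// g0.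
    + by apply: filterS fg => t H Dt; rewrite -H// -scalerBl normrZ mulrC.
  by rewrite -[X in _ --> X](mule0 (`|x|)%:E); exact: cvgeZl.
- rewrite (_ : (fun n => _) = (fun n => simple_integral I (s n) *: x)).
    by apply: cvgZ => //; exact: cvg_cst.
  apply/funext => n; have fK := proj1 (ss n).
  rewrite -[fun t => s n t *: x]/(( *:%R ^~ x) \o s n).
  rewrite (@simple_integral_label _ _ _ mI fI _ (s n @` I) (s n) ( *:%R ^~ x))//; last first.
    by move=> k _; exact: (proj2 (ss n) k).
  rewrite (@simple_integralE _ _ _ mI fI (s n) (s n @` I))//.
  rewrite !fsbig_finite//= scaler_suml.
  by apply: eq_bigr => k _; rewrite scalerA.
Qed.

Lemma has_bochner_integral_indic X (A : set (measurableTypeR R)) (x : X) :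
  measurable A -> A `<=` I ->
  has_bochner_integral I (fun t => \1_A t *: x) (fine (mu A) *: x).
Proof.
move=> mA AI.
have fA : (mu A < +oo)%E.
  by apply: (le_lt_trans _ fI); apply: le_measure => //; exact: mem_set.
have sA := simple_cst x mA.
have := has_bochner_integral_restrict mI fI mA AI (has_bochner_integral_simple sA).
rewrite (simple_integralE mA fA (finite_set1 x))//; last by move=> _ [t _ <-].
rewrite fsbig_set1.
by have -> : A `&` (fun=> x) @^-1` [set x] = A by apply: setIidl.
Qed.

(** Averaging over a cell on which the function is constant. *)
Lemma walsh_sum_of_step X n (h : R -> X) t :
  dyadic_step n h -> U t -> walsh_sum (2 ^ n) h t = h t.
Proof.
move=> sh Ut.
have p0 : (2 ^- n : R) != 0 by rewrite invr_eq0 expf_neq0// pnatr_eq0.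
apply: (scalerI p0).
apply: (has_bochner_integral_uniq mI fI
  (walsh_sum_cell n (mem_L2_walsh_integrable (mem_L2_step sh)) Ut)).
have cU : cell n t `<=` I by move=> s [Us _]; exact: unit_coW.
have := has_bochner_integral_indic (h t) (measurable_cell n Ut) cU.
rewrite [X in fine X](measure_cell n Ut)/=.
apply: has_bochner_integral_unit => s Us; rewrite indicE.
have [/set_mem [_ st]|_] := boolP (s \in cell n t); last by rewrite !scale0r.
by rewrite !scale1r; apply: sh => //; rewrite same_cellC.
Qed.

(** The defining property of the conditional expectation.  The kernel of the
    Walsh sum of length [2 ^ m] is symmetric in its two variables, so the sum
    may be moved from [f] to the indicator of [A], which it leaves unchanged.
    The common integral is the sum of the products of the Walsh coefficients of
    the indicator and of [f]. *)
Lemma walsh_sum_conditional_expectation X m (f : R -> X) (A : set R) :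
  walsh_integrable f -> dyadic_algebra m A ->
  exists y, has_bochner_integral I (fun t => \1_A t *: walsh_sum (2 ^ m) f t) y /\
    has_bochner_integral I (fun t => \1_A t *: f t) y.
Proof.
move=> wf FA; have [AU sA] := iffLR (dyadic_algebraP _ _) FA.
pose u : R -> R^o := \1_A.
have su : dyadic_step m u.
  move=> s t Us Ut st; rewrite /u !indicE; congr ((nat_of_bool _)%:R).
  apply/idP/idP; rewrite !inE; first exact: sA.
  by apply: sA => //; rewrite same_cellC.
have wu := mem_L2_walsh_integrable (mem_L2_step su).
exists (\sum_(i < 2 ^ m) walsh_coef u i *: walsh_coef f i); split.
  apply: (@has_bochner_integral_unit _ _ (fun t => \sum_(i < 2 ^ m)
      (walsh i t *: u t) *: walsh_coef f i)).
    move=> t Ut; rewrite /walsh_sum scaler_sumr; apply: eq_bigr => i _.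
    by rewrite scalerA mulrC.
  apply: has_bochner_integral_sum => // i _.
  exact: has_bochner_integral_vector.
have := has_bochner_integral_walsh (2 ^ m) (walsh_coef u) wf.
apply: has_bochner_integral_unit => t Ut; congr (_ *: _).
rewrite -[RHS]/(u t) -(walsh_sum_of_step su Ut).
by apply: eq_bigr => i _; rewrite mulrC.
Qed.

Lemma has_bochner_integral_step X n m (h : R -> X) (A : set R) :
  dyadic_step n h -> dyadic_algebra m A ->
  has_bochner_integral A h (bochner_integral A h).
Proof.
move=> sh FA; have [AU _] := iffLR (dyadic_algebraP _ _) FA.
have mA := dyadic_algebra_measurable FA.
have fA : (mu A < +oo)%E.
  apply: (le_lt_trans _ fI); apply: le_measure; rewrite ?inE//.
  exact: subset_trans unit_coW.
apply: (bochner_integralP mA fA); exists (simple_integral A h).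
apply: has_bochner_integral_simple => //.
exact: simpleS mA AU (borel_simple_dyadic_step sh).
Qed.

Lemma has_bochner_integral_dyadic X m (h : R -> X) (A : set R) x :
  dyadic_algebra m A -> has_bochner_integral A h x ->
  has_bochner_integral I (fun t => \1_A t *: h t) x.
Proof.
move=> FA; have [AU _] := iffLR (dyadic_algebraP _ _) FA.
apply: has_bochner_integral_restrict => //.
  exact: dyadic_algebra_measurable FA.
exact: subset_trans unit_coW.
Qed.

Lemma dyadic_martingale_walsh_sum X p (f : R -> X) : walsh_integrable f ->
  dyadic_martingale p (fun n => walsh_sum (2 ^ n) f).
Proof.
move=> wf; have st n := @walsh_sum_step R X n (2 ^ n) f (leqnn _).
have mU := @measurable_unit_co R; have fU := @measure_unit_co_fin R.
split=> [n np|n np A FA].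
  split.
    exists (fun=> walsh_sum (2 ^ n) f); split=> [_|t _]; last exact: cvg_cst.
    exact: dyadic_step_simple (st n).
  eexists; apply: has_bochner_integral_simple => //.
  exact: borel_simple_dyadic_step (st n).
have FA' := dyadic_algebraW (leqnSn n) FA.
have [y [y1 y2]] := walsh_sum_conditional_expectation wf FA.
have [z [z1 z2]] := walsh_sum_conditional_expectation wf FA'.
rewrite (has_bochner_integral_uniq mI fI (has_bochner_integral_dyadic FA
  (has_bochner_integral_step (st n) FA)) y1).
rewrite (has_bochner_integral_uniq mI fI (has_bochner_integral_dyadic FA
  (has_bochner_integral_step (st n.+1) FA)) z1).
exact: (has_bochner_integral_uniq mI fI z2 y2).
Qed.

Lemma dyadic_martingale_step X p (M : nat -> R -> X) n :
  dyadic_martingale p M -> (n <= p)%N -> dyadic_step n (M n).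
Proof. by move=> [+ _] np => /(_ n np) [/strongly_measurable_dyadic_step]. Qed.

(** By the martingale property the integral of [M m] over the level [n] cell of
    [t] does not depend on [m] between [n] and [p]; for [m = n] it is
    [2 ^- n *: M n t], for [m = p] it is the average computed by the Walsh
    sum. *)
Lemma dyadic_martingaleE X p (M : nat -> R -> X) n t :
  dyadic_martingale p M -> (n <= p)%N -> U t ->
  M n t = walsh_sum (2 ^ n) (M p) t.
Proof.
move=> dM np Ut; have st m := @dyadic_martingale_step X p M m dM.
have FA : dyadic_algebra n (cell n t) by exact: dyadic_algebra_cell.
have p0 : (2 ^- n : R) != 0 by rewrite invr_eq0 expf_neq0// pnatr_eq0.
have key d : (n + d <= p)%N -> has_bochner_integral I
    (fun s => \1_(cell n t) s *: M (n + d)%N s) (2 ^- n *: M n t).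
  elim: d => [|d IH]; rewrite ?addn0 ?addnS => ndp.
    rewrite -[in 2 ^- n *: _](walsh_sum_of_step (st n np) Ut).
    exact: (walsh_sum_cell n (mem_L2_walsh_integrable (mem_L2_step (st n np)))).
  have FA' := dyadic_algebraW (leq_addr d n) FA.
  have H0 := has_bochner_integral_dyadic FA (has_bochner_integral_step (st _ (ltnW ndp)) FA).
  have H1 := has_bochner_integral_dyadic FA (has_bochner_integral_step (st _ ndp) FA).
  rewrite (has_bochner_integral_uniq mI fI (IH (ltnW ndp)) H0).
  by rewrite (proj2 dM _ ndp _ FA') in H1.
apply: (scalerI p0); have := key (p - n)%N; rewrite subnKC// => /(_ (leqnn _)) H.
apply: (has_bochner_integral_uniq mI fI H); apply: walsh_sum_cell => //.
exact: mem_L2_walsh_integrable (mem_L2_step (st p (leqnn _))).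
Qed.

Lemma integral_dyadic_partition n (f : R -> \bar R) :
  measurable_fun U f -> (forall t, U t -> 0 <= f t)%E ->
  (\int[mu]_(t in U) f t =
   \sum_(0 <= k < 2 ^ n) \int[mu]_(t in dyadic_interval n k) f t)%E.
Proof.
move=> mf f0; pose F k : set (measurableTypeR R) := dyadic_interval n k.
have UE : U = \big[setU/set0]_(k <- index_iota 0 (2 ^ n)) F k.
  rewrite -bigcup_seq; apply/seteqP; split=> [t /(dyadic_interval_ex n)[k kn kt]|].
    by exists k => //=; rewrite mem_index_iota.
  by move=> t [k /=]; rewrite mem_index_iota => /= kn; exact: dyadic_interval_sub.
rewrite [in LHS]UE ge0_integral_bigsetU//.
- by move=> k; exact: measurable_itv.
- exact: iota_uniq.
- move=> i j _ _ [t [/dyadic_intervalP ti /dyadic_intervalP tj]].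
  by move: tj; rewrite ti => -[].
- by rewrite -UE.
- by rewrite -UE.
Qed.

(** Cell by cell.  On a cell [C] of measure [2 ^- n] the Walsh sum has a constant
    norm [c] with [2 ^- n * c <= \int_C `|g|], where [g] is a Borel version of
    [f].  Integrating [2 * c * `|g| <= `|g| ^+ 2 + c ^+ 2] over [C] then gives
    [2 ^- n * c ^+ 2 <= \int_C `|g| ^+ 2]. *)
Lemma integral_walsh_sum_pow2_le X n (f : R -> X) : mem_L2 I f ->
  (\int[mu]_(t in I) (`|walsh_sum (2 ^ n) f t| ^+ 2)%:E <=
   \int[mu]_(t in I) (`|f t| ^+ 2)%:E)%E.
Proof.
move=> fL2; have wf := mem_L2_walsh_integrable fL2.
have [[g [[v [sv vg]] fg]] _] := fL2.
have sE : dyadic_step n (walsh_sum (2 ^ n) f) by exact: walsh_sum_step.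
have -> : (\int[mu]_(t in I) (`|f t| ^+ 2)%:E =
    \int[mu]_(t in I) (`|g t| ^+ 2)%:E)%E.
  apply: ge0_ae_eq_integralW.
  - by move=> t _; rewrite lee_fin exprn_ge0.
  - by move=> t _; rewrite lee_fin exprn_ge0.
  - by apply: filterS fg => t H It; rewrite H.
rewrite -!integral_unit_co; try by move=> t; rewrite lee_fin exprn_ge0.
have mg : measurable_fun U (fun t => `|g t|).
  apply: (@measurable_funS _ _ _ _ I) => //; first exact: unit_coW.
  by apply: measurable_fun_norm; exists v.
have mE : measurable_fun U (fun t => `|walsh_sum (2 ^ n) f t|).
  exact: (measurable_fun_simple (fun x : X => `|x|)) (borel_simple_dyadic_step sE).
have mg2 : measurable_fun U (fun t => (`|g t| ^+ 2)%:E).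
  by apply/measurable_EFinP; exact: measurable_funX.
rewrite !(integral_dyadic_partition n); try (by move=> t _; rewrite lee_fin exprn_ge0);
  rewrite //; last first.
  by apply/measurable_EFinP; exact: measurable_funX.
rewrite big_nat [leRHS]big_nat; apply: lee_sum => k /andP[_ kn].
have kt : dyadic_interval n k (k%:R / 2 ^+ n : R).
  rewrite /dyadic_interval/= in_itv/= lexx/= ltr_pM2r ?invr_gt0 ?exprn_gt0//.
  by rewrite ltr_nat.
set t := k%:R / 2 ^+ n in kt; have Ut := dyadic_interval_sub kn kt.
rewrite -(cell_dyadic_interval kn kt); set C := cell n t.
have mC : measurable C := measurable_cell n Ut.
have CU : C `<=` U by move=> s [].
set c := `|walsh_sum (2 ^ n) f t|; have c0 : 0 <= c by exact: normr_ge0.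
have -> : (\int[mu]_(s in C) (`|walsh_sum (2 ^ n) f s| ^+ 2)%:E = (c ^+ 2 * 2 ^- n)%:E)%E.
  rewrite (eq_integral (cst (c ^+ 2)%:E)) ?integral_cst//; last first.
    by move=> s /set_mem[Us st]; rewrite /c (sE s t).
  by rewrite [X in (_ * X)%E](measure_cell n Ut).
have mgC : measurable_fun C (fun s => `|g s|) by exact: measurable_funS mg.
have mg2C : measurable_fun C (fun s => (`|g s| ^+ 2)%:E) by exact: measurable_funS mg2.
have H1 : ((2 ^- n * c)%:E <= \int[mu]_(s in C) (`|g s|)%:E)%E.
  have := norm_bochner_integral mI fI (walsh_sum_cell n wf Ut).
  rewrite normrZ ger0_norm ?invr_ge0 ?exprn_ge0// => /le_trans; apply.
  have CI : C `<=` I by exact: subset_trans unit_coW.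
  rewrite -(setIidr CI) integral_mkcondr; apply: ge0_ae_le_integralW.
  - by move=> s _; rewrite lee_fin.
  - by move=> s _; rewrite /patch; case: ifP.
  - apply: filterS fg => s H Is; rewrite /patch indicE H// -/C.
    by case: (s \in C); rewrite ?scale1r ?scale0r ?normr0.
have H2 : ((2 * c)%:E * \int[mu]_(s in C) (`|g s|)%:E <=
   \int[mu]_(s in C) (`|g s| ^+ 2)%:E + (c ^+ 2 * 2 ^- n)%:E)%E.
  rewrite -ge0_integralZl_EFin //; last 2 first.
  - exact/measurable_EFinP.
  - by rewrite mulr_ge0.
  have -> : (c ^+ 2 * 2 ^- n)%:E = (\int[mu]_(s in C) (cst (c ^+ 2)%:E s))%E.
    by rewrite integral_cst// [X in (_ * X)%E](measure_cell n Ut).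
  rewrite -ge0_integralD//; last first.
    by move=> s _; rewrite lee_fin exprn_ge0.
  apply: ge0_le_integralW => s _.
    by rewrite -EFinM lee_fin !mulr_ge0.
  rewrite -EFinM -EFinD lee_fin -subr_ge0.
  by rewrite (_ : _ - _ = (`|g s| - c) ^+ 2) ?sqr_ge0//; ring.
have H3 : ((2 * c * (2 ^- n * c))%:E <=
    \int[mu]_(s in C) (`|g s| ^+ 2)%:E + (c ^+ 2 * 2 ^- n)%:E)%E.
  apply: le_trans H2; rewrite EFinM; apply: lee_wpmul2l => //.
  by rewrite lee_fin mulr_ge0.
rewrite -(leeD2rE (x := (c ^+ 2 * 2 ^- n)%:E))// -EFinD.
by apply: le_trans H3; rewrite lee_fin le_eqVlt; apply/orP; left; apply/eqP; ring.
Qed.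

End conditional_expectation.

(** * Comparison of the two constants *)

Section walsh_martingale.
Context {R : realType}.
Local Notation mu := (@lebesgue_measure R).
Local Notation U := (`[0%R, 1%R[%classic : set (measurableTypeR R)).
Local Notation I := (`[0%R, 1%R]%classic : set (measurableTypeR R)).
Implicit Types X Y : completeNormedModType R.

Local Notation sqint D f := (\int[mu]_(t in D) (`|f t| ^+ 2)%:E)%E.

(** Squaring replaces the inequalities between norms that define the constants
    by inequalities between integrals. *)
Lemma l2norm_le X Y (D D' : set R) (f : R -> X) (g : R -> Y) (c : R) : 0 <= c ->
  (l2norm D f <= c%:E * l2norm D' g)%E = (sqint D f <= (c ^+ 2)%:E * sqint D' g)%E.
Proof.
move=> c0; have s0 Z (E : set R) (h : R -> Z) (Z' : completeNormedModType R) (k : Z -> Z') :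
    (0 <= \int[mu]_(t in E) (`|k (h t)| ^+ 2)%:E)%E.
  by apply: integral_ge0 => t _; rewrite lee_fin exprn_ge0.
rewrite /l2norm -(lee_sqrt _ (y := ((c ^+ 2)%:E * sqint D' g)%E)); last first.
  by rewrite mule_ge0 ?lee_fin ?exprn_ge0// (s0 _ D' g _ idfun).
rewrite sqrteM ?lee_fin ?exprn_ge0//; congr (_ <= _ * _)%E.
by rewrite EFin_expe sqrte_sqr gee0_abs.
Qed.

Lemma sqint_unit X (f : R -> X) : sqint I f = sqint U f.
Proof. by rewrite integral_unit_co// => t; rewrite lee_fin exprn_ge0. Qed.

Lemma eq_sqint X Y (f : R -> X) (g : R -> Y) :
  (forall t, U t -> `|f t| = `|g t|) -> sqint U f = sqint U g.
Proof. by move=> fg; apply: eq_integral => t /set_mem Ut; rewrite fg. Qed.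

Lemma measurable_sq_step X n (f : R -> X) : dyadic_step n f ->
  measurable_fun U (fun t => (`|f t| ^+ 2)%:E).
Proof.
move=> sf; apply/measurable_EFinP; apply: measurable_funX.
exact: (measurable_fun_simple (fun x : X => `|x|)) (borel_simple_dyadic_step sf).
Qed.

Lemma sqintZ X n (f : R -> X) k : dyadic_step n f ->
  sqint U (fun t => k *: f t) = ((k ^+ 2)%:E * sqint U f)%E.
Proof.
move=> sf; rewrite -ge0_integralZl_EFin ?sqr_ge0//; last first.
  exact: measurable_sq_step sf.
apply: eq_integral => t _; rewrite normrZ exprMn EFinM.
by congr (_%:E * _)%E; rewrite -normrX ger0_norm// sqr_ge0.
Qed.

(** Takes the place of the triangle inequality of L2: the constant is the same
    when the two functions satisfy the same bound. *)
Lemma sqintD_le X n (f g : R -> X) : dyadic_step n f -> dyadic_step n g ->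
  (sqint U (f \+ g) <= 2%:E * (sqint U f + sqint U g))%E.
Proof.
move=> sf sg; have mf := measurable_sq_step sf; have mg := measurable_sq_step sg.
rewrite -ge0_integralD//; try by move=> t _; rewrite lee_fin exprn_ge0.
rewrite -ge0_integralZl_EFin//; last 2 first.
- by move=> t _; rewrite -EFinD lee_fin addr_ge0// exprn_ge0.
- exact: emeasurable_funD.
apply: ge0_le_integralW => t _; first by rewrite lee_fin exprn_ge0.
rewrite -EFinD -EFinM lee_fin /=.
apply: (@le_trans _ _ ((`|f t| + `|g t|) ^+ 2)).
  by rewrite lerXn2r ?nnegrE ?addr_ge0// ler_normD.
rewrite -subr_ge0 (_ : _ - _ = (`|f t| - `|g t|) ^+ 2) ?sqr_ge0//; ring.
Qed.

Section operator.
Context {X Y : completeNormedModType R} (T : {linear X -> Y}).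
Implicit Types (f g : R -> X) (M : nat -> R -> X) (P : pred nat).

Definition martingale_part p M P t := \sum_(m < p | P m) (M m.+1 t - M m t).

Definition walsh_martingale f n := walsh_sum (2 ^ n) f.

Lemma martingale_part_step p M P :
  (forall n, (n <= p)%N -> dyadic_step n (M n)) ->
  dyadic_step p (fun t => T (martingale_part p M P t)).
Proof.
move=> sM s t Us Ut st; congr (T _); apply: eq_bigr => m _.
by congr (_ - _); [apply: (dyadic_stepW _ (sM m.+1 _)) st|
  apply: (dyadic_stepW _ (sM m _)) st] => //; exact: ltnW.
Qed.

(** A signed sum of increments is a difference of two partial sums. *)
Lemma signed_sumE p M (eps : nat -> bool) t :
  \sum_(i < p) (-1) ^+ eps i *: T (M i.+1 t - M i t) =
  T (martingale_part p M (predC eps) t) - T (martingale_part p M eps t).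
Proof.
rewrite /martingale_part !raddf_sum (bigID (fun i : 'I_p => eps i))/= addrC.
congr (_ + _).
  by apply: eq_bigr => i /negbTE ->; rewrite expr0 scale1r.
by apply: eq_bigr => i ->; rewrite expr1 scaleN1r.
Qed.

(** Walsh functions have modulus 1, so the factor [walsh k] in front of the
    martingale form of the Walsh sum disappears from the norm. *)
Lemma sqint_walsh_sum f n k : mem_L2 I f -> (k < 2 ^ n)%N ->
  sqint I (T \o walsh_sum k f) =
  sqint U (fun t => T (martingale_part n
    (walsh_martingale (fun s => walsh k s *: f s))
    (fun m => odd (k %/ 2 ^ m)) t)).
Proof.
move=> fL2 kn; rewrite sqint_unit; apply: eq_sqint => t _ /=.
have wf := mem_L2_walsh_integrable fL2.
have wg := mem_L2_walsh_integrable (mem_L2_walsh k fL2).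
by rewrite (walsh_sum_digits t wf wg kn) linearZ normrZ norm_walsh mul1r.
Qed.

Definition martingale_bound p (c : R) := forall M (eps : nat -> bool),
  dyadic_martingale p M ->
  (l2norm `[0%R, 1%R[
     (fun t => \sum_(i < p) (-1) ^+ eps i *: T (M i.+1 t - M i t))%R
   <= c%:E * l2norm `[0%R, 1%R[ (M p))%E.

Definition walsh_bound k (c : R) := forall f, mem_L2 `[0, 1] f ->
  (l2norm `[0%R, 1%R] (T \o walsh_sum k f) <= c%:E * l2norm `[0%R, 1%R] f)%E.

(** The part of a martingale on the digits of [k] is half the sum of two signed
    sums of increments, one with all signs positive and one with negative signs
    on the other indices. *)
Lemma walsh_bound_lt p k c : 0 <= c -> martingale_bound p c ->
  (k < 2 ^ p)%N -> walsh_bound k c.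
Proof.
move=> c0 Hc kp f fL2; rewrite l2norm_le// (sqint_walsh_sum fL2 kp).
set g := fun s => walsh k s *: f s; set P := fun m => odd (k %/ 2 ^ m).
have gL2 : mem_L2 I g := mem_L2_walsh k fL2.
pose M := walsh_martingale g.
have dM : dyadic_martingale p M.
  exact: dyadic_martingale_walsh_sum (mem_L2_walsh_integrable gL2).
have sM n : (n <= p)%N -> dyadic_step n (M n) := dyadic_martingale_step dM.
have Mp : (sqint U (M p) <= sqint I f)%E.
  rewrite -sqint_unit; apply: le_trans (integral_walsh_sum_pow2_le p gL2) _.
  rewrite !sqint_unit (@eq_sqint _ _ g f)// => t _.
  by rewrite normrZ norm_walsh mul1r.
pose S (eps : nat -> bool) t := \sum_(i < p) (-1) ^+ eps i *: T (M i.+1 t - M i t).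
have SE eps t : S eps t = T (martingale_part p M (predC eps) t) -
    T (martingale_part p M eps t) by exact: signed_sumE.
have bS eps : (sqint U (S eps) <= (c ^+ 2)%:E * sqint I f)%E.
  apply: le_trans (lee_wpmul2l _ Mp); last by rewrite lee_fin sqr_ge0.
  by rewrite -l2norm_le//; exact: Hc.
have sS eps : dyadic_step p (S eps).
  move=> s t Us Ut st; rewrite !SE.
  by rewrite !(@martingale_part_step p M _ sM s t).
have E : sqint U (fun t => T (martingale_part p M P t)) =
    ((2^-1 ^+ 2)%:E * sqint U (S xpred0 \+ S (predC P)))%E.
  rewrite -(@sqintZ _ p); last first.
    by move=> s t Us Ut st /=; congr (_ + _); exact: sS st.
  apply: eq_sqint => t _ /=; congr (`|_|).
  rewrite !SE.
  have -> : martingale_part p M (predC (predC P)) t = martingale_part p M P t.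
    by apply: eq_bigl => m /=; rewrite negbK.
  have -> : T (martingale_part p M xpred0 t) = 0.
    by rewrite /martingale_part big_pred0_eq raddf0.
  have -> : martingale_part p M (predC xpred0) t =
     martingale_part p M P t + martingale_part p M (predC P) t.
    by rewrite /martingale_part [LHS](bigID (fun m : 'I_p => P m)).
  rewrite subr0 (raddfD T) addrACA subrr addr0 -mulr2n.
  by rewrite -scalerMnr scalerMnl -mulr_natr mulVf ?scale1r// pnatr_eq0.
rewrite E.
apply: (@le_trans _ _ ((2^-1 ^+ 2)%:E * (2%:E * ((c ^+ 2)%:E * sqint I f +
    (c ^+ 2)%:E * sqint I f)))%E).
  apply: lee_wpmul2l; first by rewrite lee_fin sqr_ge0.
  apply: le_trans (sqintD_le (sS _) (sS _)) _.
  by apply: lee_wpmul2l; rewrite ?lee_fin// leeD.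
rewrite -mule2n -mule_natl !muleA -!EFinM.
by rewrite le_eqVlt; apply/orP; left; apply/eqP; congr (_%:E * _)%E; field.
Qed.

(** Here the Walsh sum is the conditional expectation, which includes the mean
    value and so is not a sum of increments.  Since it contracts the norm of L2,
    it suffices that [`|T x| <= c * `|x|], which is the Walsh bound of length 1
    for a constant function. *)
Lemma walsh_bound_pow2 p c : (1 <= p)%N -> 0 <= c -> martingale_bound p c ->
  walsh_bound (2 ^ p) c.
Proof.
move=> p1 c0 Hc f fL2; rewrite l2norm_le//.
have Tx (x : X) : `|T x| ^+ 2 <= c ^+ 2 * `|x| ^+ 2.
  have sx : dyadic_step 0 (fun _ : R => x) by [].
  have p2 : (1 < 2 ^ p)%N by rewrite -(expn0 2) ltn_exp2l.
  have := walsh_bound_lt c0 Hc p2 (mem_L2_step sx).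
  rewrite l2norm_le// !sqint_unit (@eq_sqint _ _ _ (fun _ : R => T x)); last first.
    by move=> t Ut /=; rewrite -[1%N](expn0 2) (walsh_sum_of_step sx).
  have mU := @measurable_unit_co R.
  have m1 : mu U = 1%E by rewrite lebesgue_measure_itv/= lte_fin ltr01 oppr0 adde0.
  rewrite !integral_cst// [X in (_ * X <= _)%E]m1 [X in (_ <= _ * (_ * X))%E]m1.
  by rewrite !mule1 -EFinM lee_fin.
apply: (@le_trans _ _ ((c ^+ 2)%:E * sqint I (walsh_sum (2 ^ p) f))%E).
  have sE : dyadic_step p (walsh_sum (2 ^ p) f) by exact: walsh_sum_step.
  rewrite !sqint_unit -(sqintZ _ sE).
  apply: ge0_le_integralW => t _; first by rewrite lee_fin exprn_ge0.
  by rewrite lee_fin normrZ exprMn (ger0_norm c0) Tx.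
apply: lee_wpmul2l; first by rewrite lee_fin sqr_ge0.
exact: integral_walsh_sum_pow2_le.
Qed.

(** The increments with positive sign are selected by the digits of some
    [k < 2 ^ p], so their sum has the norm of the Walsh sum of length [k] of
    [walsh k *: M p]; likewise for those with negative sign. *)
Lemma martingale_bound_walsh p c : 0 <= c ->
  (forall k, (1 <= k <= 2 ^ p)%N -> walsh_bound k c) ->
  martingale_bound p (2 * c).
Proof.
move=> c0 Hc M eps dM; have c20 : 0 <= 2 * c by rewrite mulr_ge0.
rewrite l2norm_le//.
have sM n : (n <= p)%N -> dyadic_step n (M n) := dyadic_martingale_step dM.
have ML2 : mem_L2 I (M p) by exact: mem_L2_step (sM p (leqnn p)).
have part P : (sqint U (fun t => T (martingale_part p M P t)) <=
    (c ^+ 2)%:E * sqint U (M p))%E.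
  have [k kp kP] := exists_binary_digits p P.
  pose f s := walsh k s *: M p s.
  have fL2 : mem_L2 I f := mem_L2_walsh k ML2.
  have wf : (fun s => walsh k s *: f s) = M p.
    by apply/funext => s; rewrite /f scalerA walsh_sqr scale1r.
  have -> : sqint U (fun t => T (martingale_part p M P t)) =
      sqint I (T \o walsh_sum k f).
    rewrite (sqint_walsh_sum fL2 kp) wf; apply: eq_sqint => t Ut.
    congr (`|T _|); apply: eq_big => [m|m _]; first by rewrite kP.
    by rewrite !(dyadic_martingaleE dM)// ltnW.
  have -> : sqint U (M p) = sqint I f.
    rewrite sqint_unit; apply: eq_sqint => t _.
    by rewrite normrZ norm_walsh mul1r.
  rewrite -l2norm_le//.
  (* The length 0 belongs to an empty [P]; the Walsh sum is then 0. *)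
  have [k0|k0] := posnP k; last first.
    by apply: Hc => //; rewrite k0 ltnW.
  rewrite l2norm_le// integral0_eq.
    apply: mule_ge0; first by rewrite lee_fin sqr_ge0.
    by apply: integral_ge0 => t _; rewrite lee_fin exprn_ge0.
  move=> t _ /=; rewrite k0 /walsh_sum big_ord0 raddf0 normr0 expr0n//.
have sP P : dyadic_step p (fun t => T (martingale_part p M P t)).
  exact: martingale_part_step.
pose N t := -1 *: T (martingale_part p M eps t).
have sN : dyadic_step p N.
  by move=> s t Us Ut st; congr (_ *: _); exact: sP st.
have -> : sqint U (fun t => \sum_(i < p) (-1) ^+ eps i *: T (M i.+1 t - M i t)) =
    sqint U ((fun t => T (martingale_part p M (predC eps) t)) \+ N).
  by apply: eq_sqint => t _; rewrite signed_sumE /N /= scaleN1r.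
apply: le_trans (sqintD_le (sP _) sN) _.
apply: (@le_trans _ _ (2%:E * ((c ^+ 2)%:E * sqint U (M p) +
    (c ^+ 2)%:E * sqint U (M p)))%E).
  apply: lee_wpmul2l; rewrite ?lee_fin//; apply: leeD => //.
  rewrite /N (sqintZ _ (sP eps)) sqrrN expr1n mul1e; exact: part.
rewrite -mule2n -mule_natl !muleA -!EFinM.
by rewrite le_eqVlt; apply/orP; left; apply/eqP; congr (_%:E * _)%E; ring.
Qed.

End operator.

Lemma least_constant_lt (P : R -> Prop) (c : R) :
  (least_constant P < c%:E)%E -> exists2 c', 0 <= c' <= c & P c'.
Proof.
move=> /ereal_inf_lt[_ [c' [c'0 Pc'] <-]]; rewrite lte_fin => c'c.
by exists c' => //; rewrite c'0 ltW.
Qed.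

Lemma least_constant_ge0 (P : R -> Prop) : (0 <= least_constant P)%E.
Proof. by apply/le_ereal_inf_tmp => _ [c [c0 _] <-]; rewrite lee_fin. Qed.

Lemma least_constant_le (P : R -> Prop) c : 0 <= c -> P c ->
  (least_constant P <= c%:E)%E.
Proof. by move=> c0 Pc; apply: ereal_inf_lbound; exists c. Qed.

End walsh_martingale.

Theorem mainTheorem1 (R : realType) (X Y : completeNormedModType R)
    (T : {linear X -> Y}) (hT : bounded_near T (nbhs (0 : X)))
    (p : nat) (hp : (1 <= p)%N) :
  (walsh_delta_max T (2 ^ p) <= martingale_mu T p)%E /\
  (martingale_mu T p <= 2%:E * walsh_delta_max T (2 ^ p))%E.
Proof.
split.
  rewrite /walsh_delta_max big_nat; apply: bigmax_le; first exact: leNye.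
  move=> k /andP[k1]; rewrite ltnS leq_eqVlt => kp.
  apply: ereal_inf_le_tmp => _ [c [c0 Hc] <-]; exists c => //; split => //.
  case/predU1P: kp => [->|kp]; first exact: walsh_bound_pow2.
  exact: walsh_bound_lt kp.
have dk k : (1 <= k <= 2 ^ p)%N -> (walsh_delta T k <= walsh_delta_max T (2 ^ p))%E.
  by move=> kp; apply: le_bigmax_seq => //; rewrite mem_index_iota ltnS.
have d0 : (0 <= walsh_delta_max T (2 ^ p))%E.
  by apply: le_trans (dk 1%N _); [exact: least_constant_ge0|rewrite expn_gt0].
case E : (walsh_delta_max T (2 ^ p)) dk d0 => [d||]// dk d0; last first.
  by rewrite gt0_muley ?leey.
(* The Walsh constants are infima, hence approached by actual bounds; half of
   [e] is the room left for them since the final bound doubles. *)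
apply/lee_addgt0Pr => e e0; rewrite lee_fin in d0.
have c0 : 0 <= d + e / 2 by rewrite addr_ge0// divr_ge0// ltW.
have -> : (2%:E * d%:E + e%:E = (2 * (d + e / 2))%:E)%E.
  by rewrite -EFinM -EFinD; congr EFin; field.
apply: least_constant_le; first by rewrite mulr_ge0.
apply: martingale_bound_walsh => // k kp f fL2.
have [|c /andP[c1 cd] Hc] := @least_constant_lt R _ (d + e / 2) (le_lt_trans (dk k kp) _).
  by rewrite lte_fin ltrDl divr_gt0.
apply: le_trans (Hc f fL2) _; apply: lee_wpmul2r; last by rewrite lee_fin.
exact: sqrte_ge0.
Qed.
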